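(* Let $b_0=\arctan\sqrt{8}=\arccos(1/3)$ and, for $k>0$, let $F_k(t)=\min\{k\,\mathrm{chd}\,t,\ \sqrt{\mathrm{chd}\,t}\}$ for $t\in[0,\pi]$, where $\mathrm{chd}\,t=2\sin(t/2)$. For every $\varepsilon\in(0,b_0)$ there exist $k\ge 1$ and $\delta>0$ such that for every spherical triangle $\Delta$ of circumscribed radius at most $b_0-\varepsilon$ the angle distortion by $F_k$ satisfies $$D(F_k,\Delta)\ge \frac12+\delta.$$
   Context: Triangles always have angles strictly between $0$ and $\pi$; a spherical triangle is a triangle isometric to a (geodesic) triangle on the unit sphere in $\mathbb{R}^3$; its circumscribed radius is the spherical radius of the spherical disc that contains it and is bounded by the circle through its vertices. If $\Delta$ is a spherical or Euclidean triangle with side lengths $a,b,c$ and $F$ is a subadditive increasing (nondecreasing) function with $F(0)=0$ and $F(t)>0$ for $t>0$, then $F\Delta$ denotes the Euclidean triangle with side lengths $F(a),F(b),F(c)$. If $\alpha,\beta,\gamma$ are the angles of $\Delta$ and $\tilde\alpha,\tilde\beta,\tilde\gamma$ the corresponding angles of $F\Delta$ (i.e. opposite to the corresponding sides), the angle distortion is $D(F,\Delta)=\min\{\tilde\alpha/\alpha,\tilde\beta/\beta,\tilde\gamma/\gamma\}$. *)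

(* Defs.v *)
From mathcomp Require Import all_boot all_order all_algebra.
From mathcomp Require Import all_classical all_reals all_analysis.
Set Implicit Arguments.
Unset Strict Implicit.
Unset Printing Implicit Defensive.
Import Order.TTheory GRing.Theory Num.Theory.
Local Open Scope classical_set_scope.
Local Open Scope ring_scope.

(** The norm [`|u|] that the library puts on row vectors is the sup norm, so
    the Euclidean structure is introduced here. *)
Definition dotp (R : realType) n (u v : 'rV[R]_n) : R :=
  \sum_(i < n) u 0 i * v 0 i.

Definition enorm (R : realType) n (u : 'rV[R]_n) : R := Num.sqrt (dotp u u).

Definition edist (R : realType) n (A B : 'rV[R]_n) : R := enorm (A - B).

(** Meaningful only for nonzero [u] and [v]. *)
Definition vec_angle (R : realType) n (u v : 'rV[R]_n) : R :=
  acos (dotp u v / (enorm u * enorm v)).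

(** [vA], [vB], [vC] are the vertices with angles alpha, beta, gamma and
    opposite sides a, b, c. *)
Record triangle (T : Type) := Triangle { vA : T; vB : T; vC : T }.

Definition usphere (R : realType) : set 'rV[R]_3 := [set x | enorm x = 1].

Definition sdist (R : realType) (x y : 'rV[R]_3) : R := acos (dotp x y).

(** Angle at [A] between the minimal geodesics from [A] to [B] and to [C]:
    the angle between the components of [B] and [C] orthogonal to [A], which
    are positive multiples of the initial directions of these geodesics. *)
Definition sph_angle (R : realType) (A B C : 'rV[R]_3) : R :=
  vec_angle (B - dotp A B *: A) (C - dotp A C *: A).

Definition eucl_angle (R : realType) n (A B C : 'rV[R]_n) : R :=
  vec_angle (B - A) (C - A).

(** A geodesic triangle on the unit sphere all of whose angles are less than
    pi is convex, so its sides are minimal geodesics of length less than pi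
    and it is determined by its vertices. *)
Definition spherical_triangle (R : realType) (D : triangle 'rV[R]_3) : Prop :=
  let: Triangle A B C := D in
  [/\ [/\ usphere A, usphere B & usphere C],
      [/\ 0 < sdist B C < pi, 0 < sdist C A < pi & 0 < sdist A B < pi]
    & [/\ 0 < sph_angle A B C < pi, 0 < sph_angle B C A < pi
        & 0 < sph_angle C A B < pi]].

(** The region bounded by the three sides: the trace on the sphere of the
    cone spanned by the vertices. *)
Definition sph_region (R : realType) (D : triangle 'rV[R]_3) : set 'rV[R]_3 :=
  [set x | usphere x /\ exists a b c : R, [/\ 0 <= a, 0 <= b, 0 <= c
     & x = a *: vA D + b *: vB D + c *: vC D]].

Definition sph_disc (R : realType) (p : 'rV[R]_3) (r : R) : set 'rV[R]_3 :=
  [set x | usphere x /\ sdist p x <= r].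

Definition circumscribed_radius (R : realType) (D : triangle 'rV[R]_3)
    (r : R) : Prop :=
  exists p : 'rV[R]_3,
    [/\ usphere p,
        [/\ sdist p (vA D) = r, sdist p (vB D) = r & sdist p (vC D) = r]
      & sph_region D `<=` sph_disc p r].

Definition euclidean_triangle (R : realType) (D : triangle 'rV[R]_2) : Prop :=
  let: Triangle A B C := D in
  [/\ A != B, B != C & C != A] /\
  [/\ 0 < eucl_angle A B C < pi, 0 < eucl_angle B C A < pi
    & 0 < eucl_angle C A B < pi].

(** [D'] is (a copy in the plane of) the triangle [F D]. *)
Definition image_triangle (R : realType) (F : R -> R) (D : triangle 'rV[R]_3)
    (D' : triangle 'rV[R]_2) : Prop :=
  [/\ euclidean_triangle D',
      edist (vB D') (vC D') = F (sdist (vB D) (vC D)),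
      edist (vC D') (vA D') = F (sdist (vC D) (vA D))
    & edist (vA D') (vB D') = F (sdist (vA D) (vB D))].

(** The angle distortion D(F, D), where [D'] is the triangle [F D]. *)
Definition angle_distortion (R : realType) (D : triangle 'rV[R]_3)
    (D' : triangle 'rV[R]_2) : R :=
  let: Triangle A B C := D in
  let: Triangle A' B' C' := D' in
  Num.min (eucl_angle A' B' C' / sph_angle A B C)
    (Num.min (eucl_angle B' C' A' / sph_angle B C A)
             (eucl_angle C' A' B' / sph_angle C A B)).

Definition chd (R : realType) (t : R) : R := 2 * sin (t / 2).

Definition Fk (R : realType) (k t : R) : R :=
  Num.min (k * chd t) (Num.sqrt (chd t)).

Definition b0 (R : realType) : R := atan (Num.sqrt 8).

Lemma b0_acos (R : realType) : b0 R = acos (1 / 3).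
Proof.
have cb : cos (b0 R) = 1 / 3.
  rewrite /b0 cos_atan sqr_sqrtr; last by rewrite ler0n.
  have -> : 1 + 8 = 3 ^+ 2 :> R by rewrite -natrX -(natrD _ 1 8).
  by rewrite sqrtr_sqr ger0_norm ?ler0n// div1r.
rewrite -cb cosK// in_itv/=; apply/andP; split.
  by rewrite -(atan0 R) /b0 le_atan// sqrtr_ge0.
by apply: (le_trans (ltW (atan_ltpi2 _))); rewrite ler_pdivrMr// ler_peMr ?pi_ge0// ler1n.
Qed.

(* Main.v *)
Require Import Defs.
From mathcomp Require Import all_boot all_order all_algebra.
From mathcomp Require Import all_classical all_reals all_analysis.
From mathcomp Require Import ring lra.
Import Order.TTheory GRing.Theory Num.Theory.
Import numFieldNormedType.Exports.
Set Implicit Arguments.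
Unset Strict Implicit.
Unset Printing Implicit Defensive.
Local Open Scope ring_scope.

(** The value [k = 10] works for every [eps]; only [delta] depends on [eps].
    Let [x], [y], [z] be the half chords [sin (a/2)], [sin (b/2)], [sin (c/2)]
    and [h = cos r], so that [h >= 1/3 + eta] with [eta > 0]. The angle at [A]
    satisfies [2yz sqrt(1-y^2) sqrt(1-z^2) cos alpha = y^2+z^2-x^2-2y^2z^2],
    and the radius enters through
    [(x+y+z)(y+z-x)(z+x-y)(x+y-z) (1-h^2) = 4x^2y^2z^2].
    If the three sides are transformed by the square root, eliminating the
    radius turns [2 alpha' > alpha] into the positivity of a cubic in a shape
    parameter [m]; for fixed [(y+z)/x] its worst case is the isosceles triangle,
    where it factors and is positive exactly because [h > 1/3], with equality
    for a face of the regular tetrahedron at [h = 1/3].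
    If [x] is above the threshold [1/200] where [F_k] switches from linear to
    square root, and is the longest side, then replacing a linear side by its
    square root only decreases [alpha']; if it is not the longest and a
    neighbouring side is below the threshold, a direct estimate shows
    [cos alpha - cos (2 alpha') >= 1/4]. If [x] is below the threshold, the
    Lipschitz bound for [F_k] gives
    [1 - cos alpha' >= 3/4 (1 - cos alpha)], hence [alpha' >= 2/3 alpha]. *)

(* The name [edist] is shadowed by the extended distance of mathcomp-analysis. *)
Local Notation edist := Defs.edist.

(** * Bounds for the sine and the arccosine *)

Lemma sin_le_id (R : realType) (t : R) : 0 <= t -> sin t <= t.
Proof.
rewrite le_eqVlt => /predU1P[<-|t0]; first by rewrite sin0.
have cs : ({within `[0, t], continuous (@sin R)})%classic.
  by apply/continuous_in_subspaceT => u _; exact: continuous_sin.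
have [c _] := MVT t0 (fun u _ => is_derive_sin u) cs.
by rewrite sin0 !subr0 => ->; rewrite ler_piMl ?cos_le1 ?ltW.
Qed.

Lemma le_acos (R : realType) (u v : R) : -1 <= u -> u <= v -> v <= 1 ->
  acos v <= acos u.
Proof.
move=> u1 uv v1.
have bu : -1 <= u <= 1 by rewrite u1 (le_trans uv).
have bv : -1 <= v <= 1 by rewrite v1 (le_trans u1).
rewrite leNgt -ltr_cos ?in_itv/= ?acos_ge0 ?acos_lepi//.
by rewrite !acosK ?in_itv//= -leNgt.
Qed.

(** * Positivity of the cubic in the shape parameter *)

Section Core.
Context {R : realType}.
Implicit Types x y z h eta P m n : R.

(** In the application [P = (y + z - x) / (x + y + z)], and [m] is [sin (2 alpha')] over the sine of
    the angle opposite [x] in the flat triangle with sides [x], [y], [z]. *)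
Definition distortion_poly h P m : R :=
  (1 - P) * m ^+ 3 + h * (1 - P) * (1 - 2 * P) * m ^+ 2
  - (P * (2 + P + P ^+ 2) - 4 * P ^+ 2 * h ^+ 2) * m + h * (1 - P) * P ^+ 2.

(* The isosceles case; at [P = 1/3], [h = 1/3], a face of the regular
   tetrahedron, the factor [n h - P] vanishes. *)
Lemma distortion_poly_sym h eta P n : 0 <= eta -> 1 / 3 + eta <= h ->
  0 < P -> P < 1 -> 0 < n -> (1 - P) * n ^+ 2 = P * (1 + 3 * P) ->
  eta * (1 - P) ^+ 2 * n ^+ 2 <= distortion_poly h P n.
Proof.
move=> e0 hh P0 P1 n0 hn.
have -> : distortion_poly h P n =
    (n * h - P) * (4 * P ^+ 2 * h + n * (1 - P) ^+ 2).
  rewrite /distortion_poly.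
  have -> : (1 - P) * n ^+ 3 = n * ((1 - P) * n ^+ 2) by ring.
  have -> : h * (1 - P) * (1 - 2 * P) * n ^+ 2 =
            h * (1 - 2 * P) * ((1 - P) * n ^+ 2) by ring.
  have -> : (n * h - P) * (4 * P ^+ 2 * h + n * (1 - P) ^+ 2) =
     4 * P ^+ 2 * h ^+ 2 * n + h * (1 - P) * ((1 - P) * n ^+ 2)
     - 4 * P ^+ 3 * h - P * n * (1 - P) ^+ 2 by ring.
  rewrite hn; ring.
(* [(1 - P) (n^2 - 9 P^2) = P (1 - 3 P)^2], which vanishes only at [P = 1/3]; hence the critical
   value [1/3] of [h]. *)
have Pn : P <= n / 3.
  rewrite -(ler_pXn2r (_ : (0 < 2)%N)) ?nnegrE//; [|lra|lra].
  have Q0 : 0 < 1 - P by lra.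
  rewrite -(ler_pM2l Q0).
  have -> : (1 - P) * (n / 3) ^+ 2 = P * (1 + 3 * P) / 9 by rewrite -hn; field.
  have : 0 <= P * (1 - 3 * P) ^+ 2 by rewrite mulr_ge0 ?sqr_ge0 ?ltW.
  have -> : P * (1 - 3 * P) ^+ 2 = 9 * (P * (1 + 3 * P) / 9 - (1 - P) * P ^+ 2)
    by field.
  lra.
have nP : n * eta <= n * h - P.
  have : n * (1 / 3 + eta) <= n * h by rewrite ler_pM2l.
  lra.
have -> : eta * (1 - P) ^+ 2 * n ^+ 2 = (n * eta) * (n * (1 - P) ^+ 2) by ring.
apply: ler_pM => //.
- exact: mulr_ge0 (ltW n0) e0.
- exact: mulr_ge0 (ltW n0) (sqr_ge0 _).
- rewrite lerDr; apply: mulr_ge0; last lra.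
  by apply: mulr_ge0; [lra|exact: sqr_ge0].
Qed.

(* [distortion_poly h P m / m ^+ 2] increases with [m]. *)
Lemma distortion_poly_ge h eta P m : 0 <= eta -> 1 / 3 + eta <= h -> h <= 1 ->
  0 < P -> P < 1 -> 0 < m -> P * (1 + 3 * P) <= (1 - P) * m ^+ 2 ->
  eta * (1 - P) ^+ 2 * m ^+ 2 <= distortion_poly h P m.
Proof.
move=> e0 hh h1 P0 P1 m0 hm.
have Q0 : 0 < 1 - P by lra.
pose n := Num.sqrt (P * (1 + 3 * P) / (1 - P)).
have n20 : 0 < P * (1 + 3 * P) / (1 - P) by rewrite divr_gt0// mulr_gt0//; lra.
have n0 : 0 < n by rewrite sqrtr_gt0.
have hn : (1 - P) * n ^+ 2 = P * (1 + 3 * P).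
  by rewrite sqr_sqrtr ?(ltW n20)// mulrC divfK// gt_eqF.
have := distortion_poly_sym e0 hh P0 P1 n0 hn.
have nm : n <= m.
  rewrite -(ler_pXn2r (_ : (0 < 2)%N)) ?nnegrE//; [|exact: ltW|exact: ltW].
  by rewrite -(ler_pM2l Q0) hn.
have Pn : P <= n.
  rewrite -(ler_pXn2r (_ : (0 < 2)%N)) ?nnegrE//; [|exact: ltW|exact: ltW].
  rewrite -(ler_pM2l Q0) hn -subr_ge0.
  have -> : P * (1 + 3 * P) - (1 - P) * P ^+ 2 = P + 2 * P ^+ 2 + P ^+ 3 by ring.
  by rewrite !addr_ge0 ?mulr_ge0 ?exprn_ge0 ?ltW.
have Pm : P <= m := le_trans Pn nm.
have P2mn : P ^+ 2 <= m * n by rewrite expr2 ler_pM ?(ltW P0).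
(* The right side is [(m n)^2] times the divided difference of [distortion_poly h P m / m^2] between
   [n] and [m]. *)
have key : 0 <= (1 - P) * (m * n) ^+ 2
    + (P * (2 + P + P ^+ 2) - 4 * P ^+ 2 * h ^+ 2) * (m * n)
    - h * (1 - P) * P ^+ 2 * (m + n).
  have mn0 : 0 < m * n by rewrite mulr_gt0.
  (* Bounding [h] by 1 and [P (m + n)] by [m n + P^2] leaves [(1 - P) (m n + P) (m n - P^2)]. *)
  have a1 : P * (1 - P) * (2 - P) * (m * n) <=
      (P * (2 + P + P ^+ 2) - 4 * P ^+ 2 * h ^+ 2) * (m * n).
    rewrite ler_pM2r// -subr_ge0.
    have -> : P * (2 + P + P ^+ 2) - 4 * P ^+ 2 * h ^+ 2 - P * (1 - P) * (2 - P)
      = 4 * P ^+ 2 * (1 - h ^+ 2) by ring.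
    apply: mulr_ge0; first by apply: mulr_ge0; rewrite ?sqr_ge0.
    by rewrite subr_ge0 expr_le1//; lra.
  have a2 : h * (1 - P) * P ^+ 2 * (m + n) <= (1 - P) * P * (m * n + P ^+ 2).
    have -> : h * (1 - P) * P ^+ 2 * (m + n) = (h * (P * (m + n))) * ((1 - P) * P)
      by ring.
    rewrite [leRHS]mulrC ler_pM2r ?mulr_gt0//.
    have : 0 <= (m - P) * (n - P) by rewrite mulr_ge0 ?subr_ge0.
    have : 0 <= (1 - h) * (P * (m + n)).
      by rewrite mulr_ge0 ?subr_ge0// mulr_ge0 ?addr_ge0 ?ltW.
    lra.
  have : 0 <= (1 - P) * (m * n + P) * (m * n - P ^+ 2).
    by apply: mulr_ge0; [apply: mulr_ge0|]; lra.
  lra.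
have : 0 <= (m - n) * ((1 - P) * (m * n) ^+ 2
    + (P * (2 + P + P ^+ 2) - 4 * P ^+ 2 * h ^+ 2) * (m * n)
    - h * (1 - P) * P ^+ 2 * (m + n)).
  by apply: mulr_ge0 => //; rewrite subr_ge0.
have -> : (m - n) * ((1 - P) * (m * n) ^+ 2
    + (P * (2 + P + P ^+ 2) - 4 * P ^+ 2 * h ^+ 2) * (m * n)
    - h * (1 - P) * P ^+ 2 * (m + n)) =
    n ^+ 2 * distortion_poly h P m - m ^+ 2 * distortion_poly h P n
  by rewrite /distortion_poly; ring.
move=> H1 H2.
have m20 : 0 < m ^+ 2 by rewrite exprn_gt0.
have n2 : 0 < n ^+ 2 by rewrite exprn_gt0.
rewrite -(ler_pM2l n2).
move: H2; rewrite -(ler_pM2l m20); lra.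
Qed.

End Core.

(** * Half chords, the circumscribed circle and the spherical law of cosines *)

Section HalfChords.
Context {R : realType}.
Implicit Types x y z h eta p q r : R.

(** Sixteen times the squared area of the flat triangle with these sides. The circumscribed radius
    of that triangle is half of [sin r = sqrt (1 - h^2)], so the equation in [half_chords] is the
    formula [R = x y z / (4 area)]. *)
Definition heron x y z : R :=
  (x + y + z) * (y + z - x) * (z + x - y) * (x + y - z).

(* [x], [y], [z] are the half chords of the sides of a spherical triangle whose
   vertices lie on a circle of spherical radius [arccos h]. *)
Definition half_chords h x y z : Prop :=
  [/\ [/\ 0 < x, 0 < y & 0 < z], [/\ x < y + z, y < z + x & z < x + y],
      0 < h & heron x y z * (1 - h ^+ 2) = 4 * x ^+ 2 * y ^+ 2 * z ^+ 2].

(** The spherical law of cosines, with [cos a = 1 - 2 x^2] and [sin a = 2 x sqrt (1 - x^2)] for a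
    side [a] of half chord [x]. *)
Definition sph_cos x y z : R :=
  (y ^+ 2 + z ^+ 2 - x ^+ 2 - 2 * y ^+ 2 * z ^+ 2) /
  (2 * y * z * (Num.sqrt (1 - y ^+ 2) * Num.sqrt (1 - z ^+ 2))).

Definition eucl_cos p q r : R := (q ^+ 2 + r ^+ 2 - p ^+ 2) / (2 * q * r).

Lemma half_chordsC h x y z : half_chords h x y z -> half_chords h x z y.
Proof.
move=> [[x0 y0 z0] [xyz yzx zxy] h0 hK]; split; [by []|by split; lra|by []|].
by rewrite -[RHS]mulrA (mulrC (z ^+ 2)) mulrA -hK /heron; ring.
Qed.

Lemma half_chords_rot h x y z : half_chords h x y z -> half_chords h y z x.
Proof.
move=> [[x0 y0 z0] [xyz yzx zxy] h0 hK]; split; [by []|by split; lra|by []|].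
have -> : 4 * y ^+ 2 * z ^+ 2 * x ^+ 2 = 4 * x ^+ 2 * y ^+ 2 * z ^+ 2 by ring.
by rewrite -hK /heron; ring.
Qed.

Lemma sph_cosC x y z : sph_cos x y z = sph_cos x z y.
Proof.
rewrite /sph_cos; congr (_ / _); first by ring.
by rewrite (mulrC (Num.sqrt _)); ring.
Qed.

Lemma eucl_cosC p q r : eucl_cos p q r = eucl_cos p r q.
Proof. by rewrite /eucl_cos; congr (_ / _); ring. Qed.

Lemma heron_gt0 h x y z : half_chords h x y z -> 0 < heron x y z.
Proof. by move=> [[? ? ?] [? ? ?] _ _]; rewrite !mulr_gt0//; lra. Qed.

Lemma half_chords_h h x y z : half_chords h x y z -> h < 1.
Proof.
move=> hc; have K0 := heron_gt0 hc; case: hc => -[x0 y0 z0] _ h0 hK.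
have : 0 < heron x y z * (1 - h ^+ 2).
  by rewrite hK; do ?[apply: mulr_gt0 => //]; rewrite ?exprn_gt0.
by rewrite pmulr_rgt0// subr_gt0 expr_lt1// ltW.
Qed.

(** A chord [2 x] of the circle is at most its diameter [2 sqrt (1 - h^2)]. The defect is
    proportional to [(y^2 + z^2 - x^2)^2]. *)
Lemma half_chords_le h x y z : half_chords h x y z ->
  h ^+ 2 <= 1 - x ^+ 2.
Proof.
move=> hc; have h1 := half_chords_h hc; case: hc => -[x0 y0 z0] _ h0 hK.
have yz0 : 0 < 4 * y ^+ 2 * z ^+ 2.
  by do ?[apply: mulr_gt0 => //]; rewrite ?exprn_gt0.
rewrite -subr_ge0 -(pmulr_rge0 _ yz0).
have -> : 4 * y ^+ 2 * z ^+ 2 * (1 - x ^+ 2 - h ^+ 2) =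
   4 * y ^+ 2 * z ^+ 2 * (1 - h ^+ 2) - heron x y z * (1 - h ^+ 2).
  by rewrite hK; ring.
have -> : 4 * y ^+ 2 * z ^+ 2 * (1 - h ^+ 2) - heron x y z * (1 - h ^+ 2) =
  (y ^+ 2 + z ^+ 2 - x ^+ 2) ^+ 2 * (1 - h ^+ 2) by rewrite /heron; ring.
by rewrite mulr_ge0 ?sqr_ge0// subr_ge0 expr_le1// ltW.
Qed.

Lemma half_chords_cos h x y z : half_chords h x y z ->
  h <= Num.sqrt (1 - x ^+ 2).
Proof.
move=> hc; have := half_chords_le hc; case: hc => _ _ h0 _ hx.
rewrite -(@ler_pXn2r _ 2)// ?nnegrE ?sqrtr_ge0//; last exact: ltW.
by rewrite sqr_sqrtr// (le_trans _ hx) ?sqr_ge0.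
Qed.

(** For the numerator [N] and denominator [W] of [sph_cos], [W^2 - N^2 = heron - 4 x^2 y^2 z^2],
    which the radius equation turns into [heron h^2]. Its positivity also gives the strict
    bounds. *)
Lemma sin_sph h x y z : half_chords h x y z ->
  -1 < sph_cos x y z < 1 /\ sin (acos (sph_cos x y z)) =
  Num.sqrt (heron x y z) * h /
  (2 * y * z * (Num.sqrt (1 - y ^+ 2) * Num.sqrt (1 - z ^+ 2))).
Proof.
move=> hc; have K0 := heron_gt0 hc.
have hcy := half_chords_rot hc; have hcz := half_chords_rot hcy.
have Yh := half_chords_cos hcy; have Zh := half_chords_cos hcz.
have y2 := half_chords_le hcy; have z2 := half_chords_le hcz.
rewrite /sph_cos.
set Y := Num.sqrt (1 - y ^+ 2) in Yh *; set Z := Num.sqrt (1 - z ^+ 2) in Zh *.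
case: hc => -[x0 y0 z0] _ h0 hK.
have Y0 := lt_le_trans h0 Yh; have Z0 := lt_le_trans h0 Zh.
have Y2 : Y ^+ 2 = 1 - y ^+ 2 by rewrite sqr_sqrtr// (le_trans _ y2) ?sqr_ge0.
have Z2 : Z ^+ 2 = 1 - z ^+ 2 by rewrite sqr_sqrtr// (le_trans _ z2) ?sqr_ge0.
set N := y ^+ 2 + _ - _ - _; set W := 2 * y * z * (Y * Z).
have W0 : 0 < W by rewrite !mulr_gt0.
have NW : 1 - (N / W) ^+ 2 = (Num.sqrt (heron x y z) * h / W) ^+ 2.
  rewrite !exprMn !exprVn sqr_sqrtr ?ltW//.
  apply: (@mulIf _ (W ^+ 2)); first by rewrite expf_neq0// gt_eqF.
  rewrite mulrBl mul1r !divfK ?expf_neq0 ?gt_eqF//.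
  have -> : W ^+ 2 = 4 * y ^+ 2 * z ^+ 2 * (Y ^+ 2 * Z ^+ 2) by rewrite /W; ring.
  rewrite Y2 Z2.
  have -> : heron x y z * h ^+ 2 = heron x y z - 4 * x ^+ 2 * y ^+ 2 * z ^+ 2.
    by rewrite -hK; ring.
  by rewrite /heron /N; ring.
have S0 : 0 < Num.sqrt (heron x y z) * h / W.
  by rewrite divr_gt0// mulr_gt0// sqrtr_gt0.
have c1 : -1 < N / W < 1.
  rewrite -ltr_norml -(@ltr_pXn2r _ 2)// ?nnegrE// expr1n.
  by rewrite real_normK ?num_real// -subr_gt0 NW exprn_gt0.
split=> //; rewrite sin_acos; last by case/andP: c1 => *; rewrite !ltW.
by rewrite NW sqrtr_sqr gtr0_norm.
Qed.

(** The radius equation gives [sqrt heron >= 2 x y z], and the square roots in the denominator are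
    at most 1. *)
Lemma sin_sph_ge h x y z : half_chords h x y z ->
  x * h <= sin (acos (sph_cos x y z)).
Proof.
move=> hc; have K0 := heron_gt0 hc; have [_ ->] := sin_sph hc.
have hcy := half_chords_rot hc; have hcz := half_chords_rot hcy.
have Yh := half_chords_cos hcy; have Zh := half_chords_cos hcz.
set Y := Num.sqrt (1 - y ^+ 2) in Yh *; set Z := Num.sqrt (1 - z ^+ 2) in Zh *.
have h1 := half_chords_h hc.
case: hc => -[x0 y0 z0] _ h0 hK.
have Y0 := lt_le_trans h0 Yh; have Z0 := lt_le_trans h0 Zh.
have Y1 : Y <= 1 by rewrite -sqrtr1 ler_wsqrtr// gerBl sqr_ge0.
have Z1 : Z <= 1 by rewrite -sqrtr1 ler_wsqrtr// gerBl sqr_ge0.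
have YZ1 : Y * Z <= 1 by rewrite mulr_ile1// ltW.
rewrite ler_pdivlMr ?mulr_gt0// mulrAC ler_pM2r//.
have yz0 : 0 < 2 * y * z by rewrite !mulr_gt0.
apply: (@le_trans _ _ (2 * x * y * z)).
  rewrite mulrA.
  have -> : 2 * x * y * z = x * (2 * y * z) * 1 by ring.
  by rewrite ler_pM2l// mulr_gt0.
have xyz0 : 0 < 2 * x * y * z by rewrite !mulr_gt0.
rewrite -(@ler_pXn2r _ 2)// ?nnegrE ?sqrtr_ge0 ?ltW// sqr_sqrtr ?ltW//.
have -> : (2 * x * y * z) ^+ 2 = 4 * x ^+ 2 * y ^+ 2 * z ^+ 2 by ring.
by rewrite -hK gtr_pMr// gtrBl exprn_gt0.
Qed.

(* With [L = x + y + z], [P = d / L] and [D = (z + x - y) (x + y - z)], the right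
   hand side is [L^3 D / (8 x^2 d)] times [distortion_poly h P m]; it is also
   proportional to the difference of the cotangents of [alpha] and
   [2 alpha'], which gives [m] its value. *)
Lemma sqrt_cot_gap h eta x y z m : half_chords h x y z -> 0 <= eta ->
  1 / 3 + eta <= h -> 0 < m ->
  let d := y + z - x in let J := 4 * y * z - d ^+ 2 in
  m ^+ 2 * ((x + y + z) * ((z + x - y) * (x + y - z))) = d * J ->
  eta * J / 2 <= m * (y ^+ 2 + z ^+ 2 - x ^+ 2 - 2 * y ^+ 2 * z ^+ 2)
                 - (d ^+ 2 - 2 * y * z) * h.
Proof.
move=> hc e0 hh m0 d J hm; have h1 := half_chords_h hc.
case: hc => -[x0 y0 z0] [xyz yzx zxy] h0 hK.
pose L := x + y + z; pose D := (z + x - y) * (x + y - z).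
have L0 : 0 < L by rewrite /L; lra.
have d0 : 0 < d by rewrite /d; lra.
have D0 : 0 < D by rewrite mulr_gt0//; lra.
have JD : J = D + 2 * x * d by rewrite /J /D /d; ring.
have J0 : 0 < J by rewrite JD addr_gt0// !mulr_gt0.
pose P := d / L.
have P0 : 0 < P by rewrite divr_gt0.
have P1 : P < 1 by rewrite ltr_pdivrMr// mul1r /d /L; lra.
have Q : 1 - P = 2 * x / L by rewrite /P /d /L; field; rewrite gt_eqF.
have m2 : m ^+ 2 = d * J / (L * D).
  by rewrite -hm mulfK// mulf_neq0 ?gt_eqF.
(* The difference is a multiple of [(y - z)^2]: equality is the isosceles case. *)
have Pm : P * (1 + 3 * P) <= (1 - P) * m ^+ 2.
  rewrite Q m2 -subr_ge0.
  have -> : 2 * x / L * (d * J / (L * D)) - P * (1 + 3 * P) =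
     4 * d ^+ 2 * (y - z) ^+ 2 / (L ^+ 2 * D).
    rewrite JD /P; apply: (@mulIf _ (L ^+ 2 * D)).
      by rewrite mulf_neq0 ?expf_neq0 ?gt_eqF.
    rewrite divfK; last by rewrite mulf_neq0 ?expf_neq0 ?gt_eqF.
    have -> : (2 * x / L * (d * (D + 2 * x * d) / (L * D)) -
      d / L * (1 + 3 * (d / L))) * (L ^+ 2 * D) =
      2 * x * d * (D + 2 * x * d) - d * D * (L + 3 * d).
      by field; rewrite !gt_eqF.
    by rewrite /D /d /L; ring.
  apply: divr_ge0; last by rewrite mulr_ge0 ?sqr_ge0// ltW.
  by rewrite mulr_ge0 ?sqr_ge0// mulr_ge0 ?sqr_ge0.
have := distortion_poly_ge e0 hh (ltW h1) P0 P1 m0 Pm.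
set N2 := y ^+ 2 + z ^+ 2 - x ^+ 2 - _.
set N1 := d ^+ 2 - _.
have c0 : 0 < 8 * x ^+ 2 * d / (L ^+ 3 * D).
  by apply: divr_gt0; do ?[apply: mulr_gt0 => //]; rewrite ?exprn_gt0.
have -> : distortion_poly h P m =
    (m * N2 - N1 * h) * (8 * x ^+ 2 * d / (L ^+ 3 * D)).
  have -> : distortion_poly h P m =
     m * ((1 - P) * m ^+ 2 - P * (2 + P + P ^+ 2) + 4 * P ^+ 2 * h ^+ 2)
     + h * (1 - P) * ((1 - 2 * P) * m ^+ 2 + P ^+ 2).
    by rewrite /distortion_poly; ring.
  (* The radius equation trades [2 y^2 z^2] for a term in [1 - h^2]; [A] and [B] then match the two
     parts of [distortion_poly] with [N2] and [- N1]. *)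
  have N2E : N2 = y ^+ 2 + z ^+ 2 - x ^+ 2 -
      (1 - h ^+ 2) * (L * d * D) / (2 * x ^+ 2).
    rewrite /N2; congr (_ - _).
    have -> : (1 - h ^+ 2) * (L * d * D) = 4 * x ^+ 2 * y ^+ 2 * z ^+ 2.
      by rewrite -hK /heron /L /d /D; ring.
    by field; rewrite gt_eqF.
  have Ld : L = d + 2 * x by rewrite /L /d; ring.
  have yzE : y ^+ 2 + z ^+ 2 - x ^+ 2 = (d ^+ 2 + 2 * x * d - D) / 2.
    by rewrite /d /D; field.
  have N1E : N1 = (d ^+ 2 - 2 * x * d - D) / 2 by rewrite /N1 /d /D; field.
  have A : (1 - P) * m ^+ 2 - P * (2 + P + P ^+ 2) + 4 * P ^+ 2 * h ^+ 2 =
       N2 * (8 * x ^+ 2 * d / (L ^+ 3 * D)).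
    rewrite Q m2 N2E JD /P yzE Ld; field.
    by rewrite !gt_eqF// -Ld.
  have B : (1 - P) * ((1 - 2 * P) * m ^+ 2 + P ^+ 2) =
       - N1 * (8 * x ^+ 2 * d / (L ^+ 3 * D)).
    rewrite Q m2 JD /P N1E Ld; field.
    by rewrite !gt_eqF// -Ld.
  by rewrite A -[h * (1 - P) * _]mulrA B; ring.
rewrite Q m2.
have -> : eta * (2 * x / L) ^+ 2 * (d * J / (L * D)) =
  eta * J / 2 * (8 * x ^+ 2 * d / (L ^+ 3 * D)).
  by field; rewrite !gt_eqF.
by rewrite ler_pM2r.
Qed.
End HalfChords.

(** * From sines and cosines to angles; the square root transform *)

Section Angles.
Context {R : realType}.
Implicit Types a b s x y z h eta p q r u : R.

Lemma acos_itv u : -1 < u < 1 -> 0 < acos u < pi.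
Proof. by case/andP=> u0 u1; rewrite acos_gt0 ?acos_ltpi// ?u0 ?u1 ltW. Qed.

Lemma cos_acos u : -1 < u < 1 -> cos (acos u) = u.
Proof. by case/andP=> u0 u1; rewrite acosK// in_itv/= !ltW. Qed.

Lemma pi_le4 : pi <= 4 :> R.
Proof. by have := @pihalf_lt2 R; lra. Qed.

(** A negative [2 b - a] would lie in [[-pi, 0)], where the sine is nonpositive; otherwise
    [sin t <= t] applies. *)
Lemma sin_gap a b s : 0 <= a <= pi -> 0 <= b <= pi / 2 -> 0 < s ->
  s <= sin (2 * b - a) -> s <= 2 * b - a.
Proof.
move=> /andP[a0 a1] /andP[b0 b1] s0 sE.
have [c0|c0] := leP 0 (2 * b - a); first exact: le_trans sE (sin_le_id c0).
suff : 0 <= sin (a - 2 * b) by rewrite -opprB sinN; lra.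
by apply: sin_ge0_pi; lra.
Qed.

(** The difference of cosines is [2 sin (b + a/2) sin (b - a/2)], whose first sine lies in
    [[0, 1]]. *)
Lemma cos_gap a b s : 0 <= a <= pi -> 0 <= b <= pi / 2 -> 0 < s ->
  s <= cos a - cos (2 * b) -> s <= 2 * b - a.
Proof.
move=> /andP[a0 a1] /andP[b0 b1] s0.
have aE : cos a = cos ((2 * b + a) / 2 - (2 * b - a) / 2).
  by congr cos; field.
have bE : cos (2 * b) = cos ((2 * b + a) / 2 + (2 * b - a) / 2).
  by congr cos; field.
rewrite aE bE cosB cosD => sE.
have {}sE : s <= 2 * (sin ((2 * b + a) / 2) * sin ((2 * b - a) / 2)) by lra.
have S0 : 0 <= sin ((2 * b + a) / 2) by apply: sin_ge0_pi; lra.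
have S1 := sin_le1 ((2 * b + a) / 2).
have [c0|c0] := leP 0 (2 * b - a).
  have c1 : 0 <= (2 * b - a) / 2 by lra.
  have := sin_le_id c1.
  have [T0|T0] := leP 0 (sin ((2 * b - a) / 2)).
    have := ler_wpM2r T0 S1; lra.
  have : 0 <= sin ((2 * b + a) / 2) * - sin ((2 * b - a) / 2).
    by apply: mulr_ge0 => //; lra.
  lra.
suff : 0 <= sin ((2 * b + a) / 2) * sin ((a - 2 * b) / 2).
  have -> : (a - 2 * b) / 2 = - ((2 * b - a) / 2) by field.
  by rewrite sinN; lra.
by apply: mulr_ge0 => //; apply: sin_ge0_pi; lra.
Qed.

Lemma cos_3 a : cos (3 * a) = 4 * cos a ^+ 3 - 3 * cos a.
Proof.
have -> : 3 * a = a *+ 2 + a by rewrite mulr2n; ring.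
rewrite cosD sin_mulr2n cos_mulr2n.
have -> : (cos a * sin a) *+ 2 * sin a = 2 * cos a * sin a ^+ 2.
  by rewrite mulr2n; ring.
by rewrite sin2cos2; ring.
Qed.

Lemma cos_third a : 0 <= a <= pi -> 1 / 2 <= cos (a / 3).
Proof.
move=> /andP[a0 a1].
have p0 := @pi_gt0 R.
(* By the triple angle formula it is a root of [(u + 1) (2 u - 1)^2]. *)
have : cos (pi / 3) = 1 / 2 :> R.
  have c0 : 0 < cos (pi / 3) :> R by apply: cos_gt0_pihalf; lra.
  have := cos_3 (pi / 3); rewrite mulrC divfK ?pnatr_eq0// cospi => cE.
  have : (cos (pi / 3 : R) + 1) * (2 * cos (pi / 3 : R) - 1) ^+ 2 = 0.
    have -> : (cos (pi / 3 : R) + 1) * (2 * cos (pi / 3 : R) - 1) ^+ 2 =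
      4 * cos (pi / 3) ^+ 3 - 3 * cos (pi / 3) + 1 by ring.
    by rewrite -cE; ring.
  move/eqP; rewrite mulf_eq0 sqrf_eq0 => /orP[]/eqP; lra.
move=> <-; rewrite leNgt ltr_cos ?in_itv/=; lra.
Qed.

(** With [u = cos (a/3)], the difference [3/4 (1 - cos a) - (1 - cos (2a/3))] is a quarter of
    [(1 - u) (2 u - 1) (6 u + 5)], and [u >= 1/2]. It vanishes at [a = pi]. *)
Lemma cos_two_thirds a b : 0 <= a <= pi -> 0 <= b <= pi ->
  3 / 4 * (1 - cos a) <= 1 - cos b -> 2 / 3 * a <= b.
Proof.
move=> ha /andP[b0 b1] hab; have u2 := cos_third ha; case/andP: ha => a0 a1.
rewrite leNgt; apply/negP => ba.
have : cos (2 / 3 * a) < cos b by rewrite ltr_cos ?in_itv/=; lra.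
have -> : 2 / 3 * a = (a / 3) *+ 2 by rewrite mulr2n; field.
have aE : a = 3 * (a / 3) by field.
move: hab; rewrite {1}aE cos_3 cos_mulr2n mulr2n => hab bu.
have u1 := cos_le1 (a / 3).
set u := cos (a / 3) in u1 u2 hab bu.
have : 0 <= (1 - u) * ((2 * u - 1) * (6 * u + 5)).
  by apply: mulr_ge0; [|apply: mulr_ge0]; lra.
lra.
Qed.

Lemma eucl_cos_itv p q r : 0 < q -> 0 < r -> p < q + r -> q < r + p -> r < p + q ->
  -1 < eucl_cos p q r < 1.
Proof.
move=> q0 r0 pqr qrp rpq.
have W0 : 0 < 2 * q * r by rewrite !mulr_gt0.
rewrite /eucl_cos ltr_pdivlMr// ltr_pdivrMr//; apply/andP; split.
  rewrite -subr_gt0.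
  have -> : q ^+ 2 + r ^+ 2 - p ^+ 2 - -1 * (2 * q * r) =
    (q + r - p) * (q + r + p) by ring.
  by apply: mulr_gt0; lra.
rewrite -subr_gt0.
have -> : 1 * (2 * q * r) - (q ^+ 2 + r ^+ 2 - p ^+ 2) =
    (p + q - r) * (r + p - q) by ring.
by apply: mulr_gt0; lra.
Qed.

(** [(q^2 + r^2 - p^2) / q] is the sum of [q] and [- (p^2 - r^2) / q], both nondecreasing in [q]. *)
Lemma eucl_cos_le p q q' r : 0 < q -> q <= q' -> 0 < r -> r ^+ 2 <= p ^+ 2 ->
  eucl_cos p q r <= eucl_cos p q' r.
Proof.
move=> q0 qq r0 rp; have q'0 := lt_le_trans q0 qq.
rewrite /eucl_cos ler_pdivrMr ?mulr_gt0// mulrAC ler_pdivlMr ?mulr_gt0//.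
rewrite -subr_ge0.
have -> : (q' ^+ 2 + r ^+ 2 - p ^+ 2) * (2 * q * r) -
  (q ^+ 2 + r ^+ 2 - p ^+ 2) * (2 * q' * r) =
  2 * r * ((q' - q) * (q * q' + (p ^+ 2 - r ^+ 2))) by ring.
apply: mulr_ge0; first by rewrite mulr_ge0// ltW.
by rewrite mulr_ge0 ?subr_ge0// addr_ge0 ?subr_ge0// mulr_ge0// ltW.
Qed.

Lemma eucl_cos_sqrt x y z : 0 < x -> 0 < y -> 0 < z ->
  eucl_cos (Num.sqrt (2 * x)) (Num.sqrt (2 * y)) (Num.sqrt (2 * z)) =
  (y + z - x) / (Num.sqrt (2 * y) * Num.sqrt (2 * z)).
Proof.
move=> x0 y0 z0; rewrite /eucl_cos !sqr_sqrtr ?mulr_ge0 ?ltW//.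
by field; rewrite !gt_eqF// sqrtr_gt0 mulr_gt0.
Qed.

(** [sin (2 alpha' - alpha)] is the product of [sin alpha / h], at least [x], and a factor that
    [sqrt_cot_gap] bounds below by [eta sin^2 alpha']; moreover [sin^2 alpha' >= 2/3 x]. *)
Lemma sqrt_angle_gap h eta x y z : half_chords h x y z -> 0 < eta ->
  1 / 3 + eta <= h ->
  2 / 3 * eta * x ^+ 2 <= 2 * acos (eucl_cos (Num.sqrt (2 * x))
     (Num.sqrt (2 * y)) (Num.sqrt (2 * z))) - acos (sph_cos x y z).
Proof.
move=> hc e0 hh.
have K0 := heron_gt0 hc; have [c1 sE] := sin_sph hc.
have sx := sin_sph_ge hc; have x1 := half_chords_le hc.
have hcy := half_chords_rot hc; have hcz := half_chords_rot hcy.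
have Yh := half_chords_cos hcy; have Zh := half_chords_cos hcz.
have y1 := half_chords_le hcy; have z1 := half_chords_le hcz.
have gap := fun m => @sqrt_cot_gap R h eta x y z m hc (ltW e0) hh.
case: (hc) => -[x0 y0 z0] [xyz yzx zxy] h0 _.
rewrite eucl_cos_sqrt//.
set S := Num.sqrt (2 * y) * _.
have S0 : 0 < S by rewrite mulr_gt0// sqrtr_gt0 mulr_gt0.
have S2 : S ^+ 2 = 4 * y * z.
  by rewrite exprMn !sqr_sqrtr ?mulr_ge0 ?ltW//; ring.
set d := y + z - x; set c' := d / S.
have d0 : 0 < d by rewrite /d; lra.
pose J := 4 * y * z - d ^+ 2.
have J0 : 0 < J.
  have -> : J = (z + x - y) * (x + y - z) + 2 * x * d by rewrite /J /d; ring.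
  by apply: addr_gt0; rewrite !mulr_gt0//; lra.
have c'0 : 0 < c' by rewrite divr_gt0.
have c'2 : 1 - c' ^+ 2 = J / S ^+ 2.
  by rewrite /J -S2 /c'; field; rewrite gt_eqF.
have c'1 : c' < 1.
  rewrite -(expr_lt1 (n := 2))// ?ltW// -subr_gt0 c'2 divr_gt0//.
  by rewrite exprn_gt0.
set a := acos (sph_cos x y z) in sE sx *; set b := acos c'.
have ai := acos_itv c1; have cA := cos_acos c1.
have c'i : -1 < c' < 1 by apply/andP; split; lra.
have /andP[b0 _] := acos_itv c'i; have cB := cos_acos c'i.
rewrite -/a -/b in ai cA b0 cB.
have b2 : b <= pi / 2 by rewrite -acos0 le_acos ?ltW//; lra.
have s'0 : 0 < sin b by apply: sin_gt0_pi; rewrite b0; have := @pi_gt0 R; lra.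
have s'2 : sin b ^+ 2 = J / S ^+ 2 by rewrite sin2cos2 cB.
apply: sin_gap.
- by case/andP: ai => *; rewrite !ltW.
- by rewrite b2 ltW.
- by rewrite !mulr_gt0// ?exprn_gt0//; lra.
have -> : 2 * b = b *+ 2 by rewrite mulr2n; ring.
rewrite sinB sin_mulr2n cos_mulr2n cB cA sE /sph_cos.
set N2 := y ^+ 2 + z ^+ 2 - x ^+ 2 - _.
set w := Num.sqrt (1 - y ^+ 2) * _.
have w0 : 0 < w by rewrite mulr_gt0//; [exact: lt_le_trans Yh|exact: lt_le_trans Zh].
set k := Num.sqrt (heron x y z).
have k0 : 0 < k by rewrite sqrtr_gt0.
have k2 : k ^+ 2 = heron x y z by rewrite sqr_sqrtr// ltW.
(* As [k] is [2 y z] times the sine of the flat angle opposite [x], [m] is the quotient of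
   [sin (2 b)] by that sine. *)
pose m := S ^+ 2 * sin b * c' / k.
have m0 : 0 < m.
  apply: divr_gt0 => //; apply: mulr_gt0 => //; apply: mulr_gt0 => //.
  exact: exprn_gt0.
have mE : m ^+ 2 * ((x + y + z) * ((z + x - y) * (x + y - z))) = d * J.
  apply: (@mulfI _ d); first by rewrite gt_eqF.
  have -> : d * (m ^+ 2 * ((x + y + z) * ((z + x - y) * (x + y - z)))) =
     m ^+ 2 * heron x y z by rewrite /heron /d; ring.
  rewrite -k2 /m.
  have -> : (S ^+ 2 * sin b * c' / k) ^+ 2 * k ^+ 2 =
     (S ^+ 2) ^+ 2 * sin b ^+ 2 * c' ^+ 2 by field; rewrite gt_eqF.
  by rewrite s'2 /c'; field; rewrite gt_eqF.
have := gap m m0 mE; rewrite -/d -/N2 -/J => gapE.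
have sinE : (c' * sin b) *+ 2 * (N2 / (2 * y * z * w))
    - (c' ^+ 2 *+ 2 - 1) * (k * h / (2 * y * z * w)) =
    (k / (2 * y * z * w)) * ((m * N2 - (d ^+ 2 - 2 * y * z) * h) / (2 * y * z)).
  have -> : c' ^+ 2 = d ^+ 2 / (4 * y * z) by rewrite -S2 /c' expr_div_n.
  rewrite /m S2 !mulr2n; field.
  by rewrite !gt_eqF.
rewrite sinE.
have kx : x <= k / (2 * y * z * w).
  move: sx; rewrite sE -/w -/k => sx.
  by rewrite -(ler_pM2r h0) mulrAC.
have yz0 : 0 < 2 * y * z by rewrite !mulr_gt0.
(* The right side is [sin^2 b], at least [2 x / (x + y + z)], and the half chords are below 1. *)
have JL : 2 / 3 * x <= J / (4 * y * z).
  have x_1 : x < 1.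
    rewrite -(expr_lt1 (n := 2))// ?ltW// -subr_gt0.
    by apply: lt_le_trans x1; rewrite exprn_gt0.
  have y_1 : y < 1.
    rewrite -(expr_lt1 (n := 2))// ?ltW// -subr_gt0.
    by apply: lt_le_trans y1; rewrite exprn_gt0.
  have z_1 : z < 1.
    rewrite -(expr_lt1 (n := 2))// ?ltW// -subr_gt0.
    by apply: lt_le_trans z1; rewrite exprn_gt0.
  have L0 : 0 < x + y + z by lra.
  apply: (@le_trans _ _ (2 * x / (x + y + z))).
    rewrite ler_pdivlMr//.
    have := ler_pM2l (x0) (x + y + z) 3; lra.
  rewrite ler_pdivrMr// mulrAC ler_pdivlMr ?mulr_gt0//.
  rewrite -subr_ge0.
  have -> : J * (x + y + z) - 2 * x * (4 * y * z) =
    d * ((z + x - y) * (x + y - z)) by rewrite /J /d; ring.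
  by rewrite !mulr_ge0 ?ltW//; lra.
have -> : 2 / 3 * eta * x ^+ 2 = x * (eta * (2 / 3 * x)) by ring.
apply: ler_pM => //; first exact: ltW.
  by rewrite !mulr_ge0// ltW.
apply: (@le_trans _ _ (eta * (J / (4 * y * z)))); first by rewrite ler_pM2l.
rewrite ler_pdivlMr//; apply: le_trans gapE.
by rewrite le_eqVlt; apply/orP; left; apply/eqP; field; rewrite !gt_eqF.
Qed.
End Angles.

(** * The transform of half chords and the angle estimates on its two branches *)

Section Scale.
Context {R : realType}.
Implicit Types a b s x y z h eta p q r u v : R.

(* [Fk 10 t] as a function of the half chord [u = sin (t / 2)]; the two branches
   meet at [u = 1 / 200]. *)
Definition scale u : R := Num.min (20 * u) (Num.sqrt (2 * u)).

Lemma scale_lin u : 0 < u -> u <= 1 / 200 -> scale u = 20 * u.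
Proof.
move=> u0 uk; rewrite /scale min_l//.
rewrite -(@ler_pXn2r _ 2)// ?nnegrE ?sqrtr_ge0//; last by lra.
rewrite sqr_sqrtr; last by lra.
have -> : (20 * u) ^+ 2 = 400 * u * u by ring.
by rewrite ler_pM2r//; lra.
Qed.

Lemma scale_sqrt u : 1 / 200 <= u -> scale u = Num.sqrt (2 * u).
Proof.
move=> uk; rewrite /scale min_r//.
have u0 : 0 < u by lra.
rewrite -(@ler_pXn2r _ 2)// ?nnegrE ?sqrtr_ge0//; last by lra.
rewrite sqr_sqrtr; last by lra.
have -> : (20 * u) ^+ 2 = 400 * u * u by ring.
by rewrite ler_pM2r//; lra.
Qed.

Lemma scale_gt0 u : 0 < u -> 0 < scale u.
Proof. by move=> u0; rewrite lt_min sqrtr_gt0 !mulr_gt0. Qed.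

Lemma scale_le_lin u : scale u <= 20 * u.
Proof. by rewrite ge_min lexx. Qed.

Lemma scale_le_sqrt u : scale u <= Num.sqrt (2 * u).
Proof. by rewrite ge_min lexx orbT. Qed.

Lemma scale_lt u v : 0 < u -> u < v -> scale u < scale v.
Proof.
move=> u0 uv; rewrite lt_min; apply/andP; split.
  by apply: le_lt_trans (scale_le_lin u) _; rewrite ltr_pM2l.
by apply: le_lt_trans (scale_le_sqrt u) _; rewrite ltr_sqrt; lra.
Qed.

(** After squaring, [2 v <= scale v ^ 2 + 2 s scale v] with [s = sqrt (2 u)] remains; if [v] is on
    the linear branch, [s >= 1/10] suffices. *)
Lemma scaleD_sqrt u v : 1 / 200 <= u -> 0 < v ->
  scale (u + v) <= scale u + scale v.
Proof.
move=> uk v0; have u0 : 0 < u by lra.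
apply: le_trans (scale_le_sqrt _) _; rewrite (scale_sqrt uk).
set s := Num.sqrt (2 * u).
have s0 : 1 / 10 <= s.
  rewrite -(@ler_pXn2r _ 2)// ?nnegrE ?sqrtr_ge0//.
  by rewrite sqr_sqrtr; lra.
have s2 : s ^+ 2 = 2 * u by rewrite sqr_sqrtr; lra.
have sv0 := scale_gt0 v0.
have vs : 2 * v <= scale v ^+ 2 + 2 * s * scale v.
  have [vk|/ltW vk] := leP v (1 / 200).
    rewrite scale_lin// -subr_ge0.
    have -> : (20 * v) ^+ 2 + 2 * s * (20 * v) - 2 * v =
       400 * v ^+ 2 + v * (40 * s - 2) by ring.
    by apply: addr_ge0; rewrite mulr_ge0 ?sqr_ge0//; lra.
  rewrite (scale_sqrt vk) sqr_sqrtr; last lra.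
  rewrite lerDl; apply: mulr_ge0; [lra|exact: sqrtr_ge0].
rewrite -(@ler_pXn2r _ 2)// ?nnegrE ?sqrtr_ge0//; last by lra.
rewrite sqr_sqrtr; last lra.
by rewrite sqrrD s2; lra.
Qed.

Lemma scaleD u v : 0 < u -> 0 < v -> scale (u + v) <= scale u + scale v.
Proof.
move=> u0 v0; have [uk|/ltW uk] := leP u (1 / 200); last exact: scaleD_sqrt.
have [vk|/ltW vk] := leP v (1 / 200).
  by apply: le_trans (scale_le_lin _) _; rewrite !scale_lin//; lra.
by rewrite addrC [leRHS]addrC; exact: scaleD_sqrt.
Qed.

Lemma scale_triangle x y z : 0 < x -> 0 < y -> 0 < z -> x < y + z ->
  scale x < scale y + scale z.
Proof.
by move=> x0 y0 z0 /(scale_lt x0) xyz; exact: lt_le_trans xyz (scaleD y0 z0).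
Qed.

(** Past the threshold both roots are at least [1/10], so the slope there is at most 10. *)
Lemma scale_lip u v : 0 < u -> u <= v -> scale v - scale u <= 20 * (v - u).
Proof.
move=> u0 uv; have [uk|/ltW uk] := leP u (1 / 200).
  by rewrite (scale_lin u0 uk); have := scale_le_lin v; lra.
rewrite (scale_sqrt uk) scale_sqrt; last by lra.
set s := Num.sqrt (2 * u); set t := Num.sqrt (2 * v).
have s0 : 1 / 10 <= s.
  rewrite -(@ler_pXn2r _ 2)// ?nnegrE ?sqrtr_ge0//.
  by rewrite sqr_sqrtr; lra.
have st : s <= t by rewrite ler_wsqrtr//; lra.
have vE : v = t ^+ 2 / 2 by rewrite sqr_sqrtr; lra.
have uE : u = s ^+ 2 / 2 by rewrite sqr_sqrtr; lra.
rewrite vE uE -subr_ge0.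
have -> : 20 * (t ^+ 2 / 2 - s ^+ 2 / 2) - (t - s) =
   (t - s) * (10 * (t + s) - 1) by field.
by apply: mulr_ge0; lra.
Qed.

Lemma scale_cos_itv h x y z : half_chords h x y z ->
  -1 < eucl_cos (scale x) (scale y) (scale z) < 1.
Proof.
move=> [[x0 y0 z0] [xyz yzx zxy] _ _].
by apply: eucl_cos_itv; rewrite ?scale_gt0//; exact: scale_triangle.
Qed.

(** The angle is at least that of the square root transform, so [sqrt_angle_gap] applies; the
    constant is its bound [2/3 eta x^2] at [x = 1/200]. *)
Lemma angle_gap_sqrt h eta x y z : half_chords h x y z -> 0 < eta ->
  1 / 3 + eta <= h -> 1 / 200 <= x ->
  eucl_cos (scale x) (scale y) (scale z) <=
  eucl_cos (Num.sqrt (2 * x)) (Num.sqrt (2 * y)) (Num.sqrt (2 * z)) ->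
  eta / 60 / 1000 <= 2 * acos (eucl_cos (scale x) (scale y) (scale z))
                 - acos (sph_cos x y z).
Proof.
move=> hc e0 hh xk le_cos.
have gap := sqrt_angle_gap hc e0 hh.
have /andP[c0 _] := scale_cos_itv hc.
have c1 : eucl_cos (Num.sqrt (2 * x)) (Num.sqrt (2 * y)) (Num.sqrt (2 * z)) <= 1.
  have sD u v : 0 < u -> 0 < v -> Num.sqrt (2 * (u + v)) <
      Num.sqrt (2 * u) + Num.sqrt (2 * v).
    move=> u0 v0; have su : 0 < Num.sqrt (2 * u) by rewrite sqrtr_gt0 mulr_gt0.
    have sv : 0 < Num.sqrt (2 * v) by rewrite sqrtr_gt0 mulr_gt0.
    rewrite -(@ltr_pXn2r _ 2)// ?nnegrE ?sqrtr_ge0//.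
    rewrite sqrrD !sqr_sqrtr; [|lra..].
    have := mulr_gt0 su sv; lra.
  case: hc => -[x0 y0 z0] [xyz yzx zxy] _ _.
  have sT u v t : 0 < u -> 0 < v -> 0 < t -> t < u + v -> Num.sqrt (2 * t) <
      Num.sqrt (2 * u) + Num.sqrt (2 * v).
    move=> u0 v0 t0 tuv; apply: le_lt_trans (sD _ _ u0 v0).
    by rewrite ler_wsqrtr//; lra.
  have := @eucl_cos_itv R (Num.sqrt (2 * x)) (Num.sqrt (2 * y)) (Num.sqrt (2 * z)).
  rewrite !sqrtr_gt0 !mulr_gt0// !sT// => /(_ isT isT isT isT isT).
  by case/andP=> _ /ltW.
have := le_acos (ltW c0) le_cos c1.
suff : eta / 60 / 1000 <= 2 / 3 * eta * x ^+ 2 by lra.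
have -> : eta / 60 / 1000 = 2 / 3 * eta * (1 / 200) ^+ 2 by field.
rewrite ler_pM2l; last by lra.
by rewrite ler_pXn2r// nnegrE; lra.
Qed.

(** With [t = (z - x) / y] in [[0, 1]], [cos (2 alpha') <= (t - 1) / 2] and
    [cos alpha >= t - 9/200], so the cosines differ by at least [91/200]. *)
Lemma angle_gap_mixed h x y z : half_chords h x y z -> 1 / 3 <= h ->
  1 / 200 <= x -> y <= 1 / 200 -> x <= z ->
  1 / 4 <= 2 * acos (eucl_cos (scale x) (scale y) (scale z))
           - acos (sph_cos x y z).
Proof.
move=> hc hh xk yk xz.
have [c1 _] := sin_sph hc; have f1 := scale_cos_itv hc.
have hcy := half_chords_rot hc; have hcz := half_chords_rot hcy.
have Yh := half_chords_cos hcy; have Zh := half_chords_cos hcz.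
have h1 := half_chords_h hc; have z_le := half_chords_le hcz.
case: (hc) => -[x0 y0 z0] [xyz yzx zxy] h0 _.
have z1 : z < 1.
  rewrite -(expr_lt1 (n := 2))// ?ltW// -subr_gt0.
  by apply: lt_le_trans z_le; rewrite exprn_gt0.
have sz0 := scale_gt0 z0.
have sz2 : scale z ^+ 2 = 2 * z.
  by rewrite scale_sqrt; [rewrite sqr_sqrtr; lra|lra].
have sx2 : scale x ^+ 2 = 2 * x.
  by rewrite scale_sqrt//; rewrite sqr_sqrtr; lra.
have syE := scale_lin y0 yk.
have fE : eucl_cos (scale x) (scale y) (scale z) =
   (400 * y ^+ 2 + 2 * (z - x)) / (40 * y * scale z).
  by rewrite /eucl_cos sz2 sx2 syE; congr (_ / _); ring.
pose t := (z - x) / y.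
have t0 : 0 <= t by apply: divr_ge0; lra.
have t1 : t <= 1 by rewrite ler_pdivrMr//; lra.
have zE : z = x + t * y by rewrite /t divfK ?gt_eqF//; ring.
(* With [v = 200 y <= 1], [v + t] is at most [1 + t] and at most [1 + t v], and [1 + t v <= 200 z]
   because [x >= 1/200]. *)
have f2 : 2 * eucl_cos (scale x) (scale y) (scale z) ^+ 2 <= (1 + t) / 2.
  rewrite fE.
  have -> : 2 * ((400 * y ^+ 2 + 2 * (z - x)) / (40 * y * scale z)) ^+ 2 =
     (200 * y + t) ^+ 2 / (400 * z).
    rewrite expr_div_n exprMn sz2 {1}zE; field.
    by rewrite !gt_eqF.
  rewrite ler_pdivrMr ?mulr_gt0//.
  have v1 : 200 * y <= 1 by lra.
  apply: (@le_trans _ _ ((1 + t) * (1 + t * (200 * y)))).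
    rewrite expr2; apply: ler_pM; [lra|lra|lra|].
    rewrite -subr_ge0.
    have -> : 1 + t * (200 * y) - (200 * y + t) = (1 - t) * (1 - 200 * y) by ring.
    by apply: mulr_ge0; lra.
  have -> : (1 + t) / 2 * (400 * z) = (1 + t) * (200 * z) by field.
  by rewrite ler_pM2l; lra.
have f0 : 0 <= eucl_cos (scale x) (scale y) (scale z).
  rewrite fE divr_ge0//; first by rewrite addr_ge0 ?mulr_ge0 ?sqr_ge0//; lra.
  by rewrite !mulr_ge0// ltW.
(* The error comes from [y z <= 1/200] divided by [Y Z >= 1/9]. *)
have cE : t - 9 / 200 <= sph_cos x y z.
  rewrite /sph_cos.
  set Y := Num.sqrt (1 - y ^+ 2) in Yh *; set Z := Num.sqrt (1 - z ^+ 2) in Zh *.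
  have Y1 : Y <= 1 by rewrite -sqrtr1 ler_wsqrtr// gerBl sqr_ge0.
  have Z1 : Z <= 1 by rewrite -sqrtr1 ler_wsqrtr// gerBl sqr_ge0.
  have w1 : Y * Z <= 1 by apply: mulr_ile1 => //; lra.
  have w9 : 1 / 9 <= Y * Z.
    have -> : 1 / 9 = 1 / 3 * (1 / 3) :> R by field.
    by apply: ler_pM; lra.
  have w0 : 0 < Y * Z by lra.
  have yz0 : 0 < 2 * y * z by rewrite !mulr_gt0.
  rewrite ler_pdivlMr; last exact: mulr_gt0.
  have -> : (t - 9 / 200) * (2 * y * z * (Y * Z)) =
    2 * y * z * (t * (Y * Z) - 9 / 200 * (Y * Z)) by ring.
  apply: (@le_trans _ _ (2 * y * z * (t - y * z))).
    rewrite ler_pM2l//.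
    have := ler_wpM2l t0 w1.
    have : y * z <= y * 1 by rewrite ler_pM2l// ltW.
    lra.
  rewrite -subr_ge0.
  have -> : y ^+ 2 + z ^+ 2 - x ^+ 2 - 2 * y ^+ 2 * z ^+ 2 - 2 * y * z * (t - y * z)
    = y ^+ 2 * (1 - t ^+ 2).
    have -> : x = z - t * y by rewrite {1}zE; ring.
    ring.
  by rewrite mulr_ge0 ?sqr_ge0// subr_ge0 expr_le1.
have p0 := @pi_gt0 R.
set f := eucl_cos _ _ _ in f1 f2 f0 *; set c := sph_cos x y z in c1 cE *.
apply: (@cos_gap R (acos c) (acos f)); last 1 first.
- have -> : 2 * acos f = acos f *+ 2 by rewrite mulr2n; ring.
  by rewrite cos_mulr2n !cos_acos// mulr2n; lra.
- by have /andP[? ?] := acos_itv c1; rewrite !ltW.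
- have /andP[? ?] := acos_itv f1; apply/andP; split; first exact: ltW.
  by rewrite -acos0 le_acos//; case/andP: f1 => *; lra.
- by lra.
Qed.

(** With [D = x^2 - (z - y)^2], [1 - cos alpha' >= 400 D / (2 scale y scale z)] by the Lipschitz
    bound, and [1 - cos alpha <= D / W]. The factor [3/4] needed by [cos_two_thirds] is then the
    inequality [key]. *)
Lemma angle_gap_lin h x y z : half_chords h x y z -> 1 / 3 <= h ->
  x <= 1 / 200 ->
  2 / 3 * acos (sph_cos x y z) <=
  acos (eucl_cos (scale x) (scale y) (scale z)).
Proof.
wlog yz : y z / y <= z => [wl hc|hc hh xk].
  have [/wl//|/ltW /wl] := leP y z; first exact.
  by rewrite sph_cosC eucl_cosC; apply; exact: half_chordsC.
have [c1 _] := sin_sph hc; have f1 := scale_cos_itv hc.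
have hcy := half_chords_rot hc; have hcz := half_chords_rot hcy.
have Yh := half_chords_cos hcy; have Zh := half_chords_cos hcz.
have y_le := half_chords_le hcy; have z_le := half_chords_le hcz.
case: (hc) => -[x0 y0 z0] [xyz yzx zxy] h0 _.
apply: cos_two_thirds.
- by have /andP[? ?] := acos_itv c1; rewrite !ltW.
- by have /andP[? ?] := acos_itv f1; rewrite !ltW.
rewrite !cos_acos//.
pose D := x ^+ 2 - (z - y) ^+ 2.
have D0 : 0 <= D.
  have -> : D = (x + y - z) * (x - y + z) by rewrite /D; ring.
  by apply: mulr_ge0; lra.
have sy0 := scale_gt0 y0; have sz0 := scale_gt0 z0.
have szy : 0 <= scale z - scale y.
  by move: yz; rewrite le_eqVlt => /predU1P[->|/(scale_lt y0)]; lra.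
have fE : 400 * D / (2 * scale y * scale z) <=
    1 - eucl_cos (scale x) (scale y) (scale z).
  rewrite /eucl_cos (scale_lin x0 xk).
  rewrite ler_pdivrMr ?mulr_gt0// mulrBl divfK ?gt_eqF ?mulr_gt0// mul1r.
  have : (scale z - scale y) ^+ 2 <= (20 * (z - y)) ^+ 2.
    rewrite ler_pXn2r// ?nnegrE//; last by lra.
    exact: scale_lip.
  rewrite /D; lra.
apply: le_trans fE; rewrite /sph_cos.
set Y := Num.sqrt (1 - y ^+ 2) in Yh *; set Z := Num.sqrt (1 - z ^+ 2) in Zh *.
have Y2 : Y ^+ 2 = 1 - y ^+ 2 by rewrite sqr_sqrtr// (le_trans _ y_le) ?sqr_ge0.
have Z2 : Z ^+ 2 = 1 - z ^+ 2 by rewrite sqr_sqrtr// (le_trans _ z_le) ?sqr_ge0.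
have Y0 : 0 < Y := lt_le_trans h0 Yh.
have Z0 : 0 < Z := lt_le_trans h0 Zh.
have w0 : 0 < Y * Z by rewrite mulr_gt0.
have yz1 : y * z <= 1.
  have : 0 <= (z - y) ^+ 2 by rewrite sqr_ge0.
  have := sqr_ge0 h; lra.
have wyz : Y * Z <= 1 - y * z.
  rewrite -(@ler_pXn2r _ 2)// ?nnegrE; [|exact: ltW|by lra].
  rewrite exprMn Y2 Z2 -subr_ge0.
  have -> : (1 - y * z) ^+ 2 - (1 - y ^+ 2) * (1 - z ^+ 2) = (z - y) ^+ 2 by ring.
  exact: sqr_ge0.
set W := 2 * y * z * (Y * Z).
have W0 : 0 < W by rewrite !mulr_gt0.
have cE : 1 - (y ^+ 2 + z ^+ 2 - x ^+ 2 - 2 * y ^+ 2 * z ^+ 2) / W <= D / W.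
  rewrite ler_pdivlMr// mulrBl divfK ?gt_eqF// mul1r.
  have : 2 * y * z * (Y * Z) <= 2 * y * z * (1 - y * z).
    by rewrite ler_pM2l// !mulr_gt0.
  rewrite -/W /D; lra.
apply: (@le_trans _ _ (3 / 4 * (D / W))); first by rewrite ler_pM2l.
suff key : 3 * (scale y * scale z) <= 1600 * (y * z * (Y * Z)).
  rewrite mulrA ler_pdivrMr// [leRHS]mulrAC ler_pdivlMr; last by rewrite !mulr_gt0.
  rewrite /W -subr_ge0.
  have -> : 400 * D * (2 * y * z * (Y * Z)) - 3 / 4 * D * (2 * scale y * scale z)
    = D / 2 * (1600 * (y * z * (Y * Z)) - 3 * (scale y * scale z)) by field.
  by apply: mulr_ge0; lra.
have yz0 : 0 < y * z by rewrite mulr_gt0.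
(* For [z <= 1/2] the linear bound on [scale] and [Y Z >= 3/4] suffice. Otherwise [y > 1/4], since
   [x] is tiny, and the square root bound suffices with [Y Z >= 1/9]. *)
have [z2|z2] := leP z (1 / 2).
  have w3 : 3 / 4 <= Y * Z.
    rewrite -(@ler_pXn2r _ 2)// ?nnegrE; [|by lra|exact: ltW].
    rewrite [leRHS]exprMn Y2 Z2.
    have -> : (3 / 4) ^+ 2 = 3 / 4 * (3 / 4) :> R by ring.
    have s2 u : 0 < u -> u <= 1 / 2 -> 3 / 4 <= 1 - u ^+ 2.
      move=> u0 u2; have : u ^+ 2 <= (1 / 2) ^+ 2.
        by rewrite ler_pXn2r// nnegrE; lra.
      lra.
    by apply: ler_pM; rewrite ?s2//; lra.
  have : scale y * scale z <= (20 * y) * (20 * z).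
    by apply: ler_pM; rewrite ?scale_le_lin//; exact: ltW.
  have : y * z * (3 / 4) <= y * z * (Y * Z) by rewrite ler_pM2l.
  lra.
have w9 : 1 / 9 <= Y * Z.
  have -> : 1 / 9 = 1 / 3 * (1 / 3) :> R by field.
  by apply: ler_pM; lra.
pose S := Num.sqrt (y * z).
have S2 : S ^+ 2 = y * z by rewrite sqr_sqrtr// ltW.
have S4 : 1 / 4 <= S.
  rewrite -(@ler_pXn2r _ 2)// ?nnegrE ?sqrtr_ge0//.
  rewrite S2 expr2; apply: ler_pM; lra.
have : scale y * scale z <= 2 * S.
  rewrite -(@ler_pXn2r _ 2)// ?nnegrE; [|exact: ltW (mulr_gt0 _ _)|by lra].
  have -> : (2 * S) ^+ 2 = Num.sqrt (2 * y) ^+ 2 * Num.sqrt (2 * z) ^+ 2.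
    by rewrite !sqr_sqrtr; [rewrite exprMn S2; ring|lra..].
  rewrite exprMn; apply: ler_pM; rewrite ?sqr_ge0// ler_pXn2r// ?nnegrE
    ?sqrtr_ge0// ?scale_le_sqrt//; exact: ltW.
have : y * z * (1 / 9) <= y * z * (Y * Z) by rewrite ler_pM2l.
have : S / 4 <= S ^+ 2 by rewrite expr2 mulrC; apply: ler_pM; lra.
rewrite S2; lra.
Qed.

Lemma angle_distort h eta x y z : half_chords h x y z -> 0 < eta ->
  1 / 3 + eta <= h ->
  (1 / 2 + eta / 480 / 1000) * acos (sph_cos x y z) <=
  acos (eucl_cos (scale x) (scale y) (scale z)).
Proof.
move=> hc e0 hh; have h1 := half_chords_h hc; have h3 : 1 / 3 <= h by lra.
have [c1 _] := sin_sph hc; have /andP[a0 a1] := acos_itv c1.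
have p4 := @pi_le4 R.
set a := acos (sph_cos x y z) in a0 a1 *.
(* By [a <= pi <= 4]; the bound is half of the gap in [angle_gap_sqrt], as that gap concerns
   [2 alpha']. *)
have da : eta / 480 / 1000 * a <= eta / 120 / 1000.
  have -> : eta / 120 / 1000 = eta / 480 / 1000 * 4 by field.
  by rewrite ler_pM2l; lra.
case: (hc) => -[x0 y0 z0] _ h0 _.
have [/(angle_gap_lin hc h3)|xk] := leP x (1 / 200).
  rewrite -/a => ab; apply: le_trans ab.
  by rewrite ler_pM2r//; lra.
have {xk} xk := ltW xk.
have sqr u : 0 < u -> Num.sqrt (2 * u) ^+ 2 = 2 * u.
  by move=> u0; rewrite sqr_sqrtr; lra.
have [le_cos|] := pselect (eucl_cos (scale x) (scale y) (scale z) <=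
  eucl_cos (Num.sqrt (2 * x)) (Num.sqrt (2 * y)) (Num.sqrt (2 * z))).
  by have := angle_gap_sqrt hc e0 hh xk le_cos; rewrite -/a; lra.
move=> /negP; rewrite -ltNge => lt_cos.
(* Now [alpha'] is smaller than for the square root transform. This fails if both neighbours are
   past the threshold, or if [x] is the longest side by [eucl_cos_le]; what remains is
   [angle_gap_mixed], up to exchanging [y] and [z]. *)
suff : 1 / 4 <= 2 * acos (eucl_cos (scale x) (scale y) (scale z)) - a by lra.
have [yk|/ltW yk] := leP y (1 / 200).
  have [xz|/ltW zx] := leP x z; first exact: (angle_gap_mixed hc).
  have [xy|/ltW yx] := leP x y.
    have zk : z <= 1 / 200 by lra.
    by rewrite /a sph_cosC eucl_cosC; apply: (angle_gap_mixed (half_chordsC hc)).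
  exfalso; move: lt_cos; rewrite (scale_sqrt xk) ltNge => /negP; apply.
  apply: le_trans (eucl_cos_le (scale_gt0 y0) (scale_le_sqrt y) (scale_gt0 z0) _) _.
    rewrite sqr//; apply: le_trans (_ : 2 * z <= _); last by lra.
    rewrite -sqr// ler_pXn2r ?nnegrE ?sqrtr_ge0 ?scale_le_sqrt//.
    exact: ltW (scale_gt0 z0).
  rewrite eucl_cosC [leRHS]eucl_cosC; apply: eucl_cos_le.
  - exact: scale_gt0.
  - exact: scale_le_sqrt.
  - by rewrite sqrtr_gt0 mulr_gt0.
  - by rewrite !sqr//; lra.
have [zk|/ltW zk] := leP z (1 / 200).
  have [xy|/ltW yx] := leP x y.
    by rewrite /a sph_cosC eucl_cosC; apply: (angle_gap_mixed (half_chordsC hc)).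
  exfalso; move: lt_cos; rewrite (scale_sqrt xk) (scale_sqrt yk).
  rewrite ltNge => /negP; apply.
  rewrite eucl_cosC [leRHS]eucl_cosC; apply: eucl_cos_le.
  - exact: scale_gt0.
  - exact: scale_le_sqrt.
  - by rewrite sqrtr_gt0 mulr_gt0.
  - by rewrite !sqr//; lra.
by exfalso; move: lt_cos; rewrite !scale_sqrt// ltxx.
Qed.
End Scale.

(** * Inner products, angles and half chords of points on the sphere *)

Section Vectors.
Context {R : realType}.

Lemma dotpC n (u v : 'rV[R]_n) : dotp u v = dotp v u.
Proof. by apply: eq_bigr => i _; rewrite mulrC. Qed.

Lemma dotpBl n (u v w : 'rV[R]_n) : dotp (u - v) w = dotp u w - dotp v w.
Proof. by rewrite -sumrB; apply: eq_bigr => i _; rewrite !mxE mulrBl. Qed.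

Lemma dotpBr n (u v w : 'rV[R]_n) : dotp w (u - v) = dotp w u - dotp w v.
Proof. by rewrite dotpC dotpBl !(dotpC w). Qed.

Lemma dotpZl n k (u v : 'rV[R]_n) : dotp (k *: u) v = k * dotp u v.
Proof. by rewrite mulr_sumr; apply: eq_bigr => i _; rewrite !mxE mulrA. Qed.

Lemma dotpZr n k (u v : 'rV[R]_n) : dotp v (k *: u) = k * dotp v u.
Proof. by rewrite dotpC dotpZl dotpC. Qed.

Lemma dotp_ge0 n (u : 'rV[R]_n) : 0 <= dotp u u.
Proof. by apply: sumr_ge0 => i _; rewrite -expr2 sqr_ge0. Qed.

Lemma enorm_sqr n (u : 'rV[R]_n) : enorm u ^+ 2 = dotp u u.
Proof. by rewrite sqr_sqrtr// dotp_ge0. Qed.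

Lemma edistC n (A B : 'rV[R]_n) : edist A B = edist B A.
Proof.
rewrite /edist /enorm !dotpBl !dotpBr (dotpC A B); congr Num.sqrt; ring.
Qed.

Lemma eucl_angleE n (A B C : 'rV[R]_n) :
  eucl_angle A B C = acos (eucl_cos (edist B C) (edist C A) (edist A B)).
Proof.
rewrite /eucl_angle /vec_angle (edistC A B) /eucl_cos /edist; congr acos.
have -> : enorm (C - A) ^+ 2 + enorm (B - A) ^+ 2 - enorm (B - C) ^+ 2 =
    2 * dotp (B - A) (C - A).
  rewrite !enorm_sqr !dotpBl !dotpBr.
  rewrite (dotpC C A) (dotpC B A) (dotpC C B); ring.
have -> : 2 * enorm (C - A) * enorm (B - A) = 2 * (enorm (B - A) * enorm (C - A)).
  by ring.
by rewrite [in RHS]invfM mulrACA mulfV ?mul1r// pnatr_eq0.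
Qed.

Lemma dotp_sphere n (A : 'rV[R]_n) : enorm A = 1 -> dotp A A = 1.
Proof. by move=> A1; rewrite -enorm_sqr A1 expr1n. Qed.

Lemma dotp_bound n (A B : 'rV[R]_n) : enorm A = 1 -> enorm B = 1 ->
  -1 <= dotp A B <= 1.
Proof.
move=> /dotp_sphere A1 /dotp_sphere B1.
have := dotp_ge0 (A - B).
have := dotp_ge0 (A - (-1) *: B).
rewrite !dotpBl !dotpBr !dotpZl !dotpZr A1 B1 (dotpC B A) => h1 h2.
apply/andP; split; lra.
Qed.

Lemma dotp_itv n (A B : 'rV[R]_n) : enorm A = 1 -> enorm B = 1 ->
  0 < acos (dotp A B) < pi -> -1 < dotp A B < 1.
Proof.
move=> A1 B1; have /andP[] := dotp_bound A1 B1.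
rewrite le_eqVlt => /predU1P[<-|->]; first by rewrite acosN1 ltxx andbF.
by rewrite le_eqVlt => /predU1P[->|->//]; rewrite acos1 !ltxx.
Qed.

(* [sin (t / 2)] for two points of the sphere at distance [t]. *)
Definition half_chord (A B : 'rV[R]_3) : R := Num.sqrt ((1 - dotp A B) / 2).

Lemma half_chord_gt0 (A B : 'rV[R]_3) : dotp A B < 1 -> 0 < half_chord A B.
Proof. by move=> AB; rewrite sqrtr_gt0; lra. Qed.

Lemma half_chord_sqr (A B : 'rV[R]_3) : dotp A B <= 1 ->
  half_chord A B ^+ 2 = (1 - dotp A B) / 2.
Proof. by move=> AB; rewrite sqr_sqrtr//; lra. Qed.

Lemma chd_sdist (A B : 'rV[R]_3) : -1 < dotp A B < 1 ->
  chd (sdist A B) = 2 * half_chord A B.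
Proof.
move=> AB; rewrite /chd /sdist; congr (_ * _).
have /andP[s0 s1] := acos_itv AB.
have s2 : 0 <= sin (acos (dotp A B) / 2) by apply: sin_ge0_pi; lra.
rewrite -[LHS]ger0_norm// -sqrtr_sqr; congr Num.sqrt.
have := cos_acos AB; rewrite {1}(_ : acos _ = (acos (dotp A B) / 2) *+ 2).
  by rewrite cos_mulr2n sin2cos2 mulr2n; lra.
by rewrite mulr2n; field.
Qed.

Lemma Fk_sdist (A B : 'rV[R]_3) : -1 < dotp A B < 1 ->
  Fk 10 (sdist A B) = scale (half_chord A B).
Proof.
move=> AB; rewrite /Fk chd_sdist// /scale mulrA.
by have -> : 10 * 2 = 20 :> R by rewrite -natrM.
Qed.

Lemma sph_angle_dotp (A B C : 'rV[R]_3) :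
  enorm A = 1 -> enorm B = 1 -> enorm C = 1 ->
  sph_angle A B C = acos ((dotp B C - dotp A B * dotp C A) /
    (Num.sqrt (1 - dotp A B ^+ 2) * Num.sqrt (1 - dotp C A ^+ 2))).
Proof.
move=> /dotp_sphere A1 /dotp_sphere B1 /dotp_sphere C1.
rewrite /sph_angle /vec_angle /enorm !dotpBl !dotpBr !dotpZl !dotpZr A1 B1 C1.
rewrite (dotpC A C) (dotpC B A).
by congr (acos (_ / (Num.sqrt _ * Num.sqrt _))); ring.
Qed.

Lemma sph_angleE (A B C : 'rV[R]_3) :
  enorm A = 1 -> enorm B = 1 -> enorm C = 1 ->
  -1 < dotp A B < 1 -> -1 < dotp B C < 1 -> -1 < dotp C A < 1 ->
  sph_angle A B C =
  acos (sph_cos (half_chord B C) (half_chord C A) (half_chord A B)).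
Proof.
move=> A1 B1 C1 /andP[_ AB] /andP[_ BC] /andP[_ CA].
rewrite sph_angle_dotp//; congr acos; rewrite /sph_cos.
have x2 := half_chord_sqr (ltW BC); have y2 := half_chord_sqr (ltW CA).
have z2 := half_chord_sqr (ltW AB).
have y0 := half_chord_gt0 CA; have z0 := half_chord_gt0 AB.
set x := half_chord B C in x2 *; set y := half_chord C A in y2 y0 *.
set z := half_chord A B in z2 z0 *.
have -> : dotp B C = 1 - 2 * x ^+ 2 by rewrite x2; field.
have sq u : 0 < u -> Num.sqrt (1 - (1 - 2 * u ^+ 2) ^+ 2) =
    2 * u * Num.sqrt (1 - u ^+ 2).
  move=> u0; have -> : 1 - (1 - 2 * u ^+ 2) ^+ 2 = (2 * u) ^+ 2 * (1 - u ^+ 2).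
    by ring.
  by rewrite sqrtrM ?sqr_ge0// sqrtr_sqr ger0_norm// mulr_ge0// ltW.
have -> : dotp C A = 1 - 2 * y ^+ 2 by rewrite y2; field.
have -> : dotp A B = 1 - 2 * z ^+ 2 by rewrite z2; field.
rewrite !sq//.
set Y := Num.sqrt _; set Z := Num.sqrt _.
have -> : 1 - 2 * x ^+ 2 - (1 - 2 * z ^+ 2) * (1 - 2 * y ^+ 2) =
   2 * (y ^+ 2 + z ^+ 2 - x ^+ 2 - 2 * y ^+ 2 * z ^+ 2) by ring.
have -> : 2 * z * Y * (2 * y * Z) = 2 * (2 * y * z * (Z * Y)) by ring.
by rewrite invfM mulrACA mulfV ?mul1r// pnatr_eq0.
Qed.

(** The Gram determinant of three unit vectors with pairwise inner products [u], [v], [w]. *)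
Definition gram (u v w : R) : R :=
  1 + 2 * u * v * w - u ^+ 2 - v ^+ 2 - w ^+ 2.

(* A point [p] with [p.A = p.B = p.C = h] satisfies
   [det (A, B, C) p = h (A x B + B x C + C x A)]; take squared norms. *)
Lemma gram_circumcenter (A B C p : 'rV[R]_3) h :
  enorm A = 1 -> enorm B = 1 -> enorm C = 1 -> enorm p = 1 ->
  dotp p A = h -> dotp p B = h -> dotp p C = h ->
  let u := 1 - dotp B C in let v := 1 - dotp C A in let w := 1 - dotp A B in
  0 <= gram (dotp B C) (dotp C A) (dotp A B) /\
  gram (dotp B C) (dotp C A) (dotp A B) =
  h ^+ 2 * (2 * (u * v + v * w + w * u) - u ^+ 2 - v ^+ 2 - w ^+ 2).
Proof.
move=> /dotp_sphere + /dotp_sphere + /dotp_sphere + /dotp_sphere.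
rewrite /dotp !big_ord_recl !big_ord0 !addr0.
set i1 := lift _ _; set i2 := lift _ _.
move: (A 0 ord0) (A 0 i1) (A 0 i2) (B 0 ord0) (B 0 i1) (B 0 i2)
  (C 0 ord0) (C 0 i1) (C 0 i2) (p 0 ord0) (p 0 i1) (p 0 i2).
move=> a1 a2 a3 b1 b2 b3 c1 c2 c3 p1 p2 p3 AA BB CC pp pA pB pC.
pose det := a1 * (b2 * c3 - b3 * c2) + a2 * (b3 * c1 - b1 * c3)
  + a3 * (b1 * c2 - b2 * c1).
pose n1 := a2 * b3 - a3 * b2 + (b2 * c3 - b3 * c2) + (c2 * a3 - c3 * a2).
pose n2 := a3 * b1 - a1 * b3 + (b3 * c1 - b1 * c3) + (c3 * a1 - c1 * a3).
pose n3 := a1 * b2 - a2 * b1 + (b1 * c2 - b2 * c1) + (c1 * a2 - c2 * a1).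
have d1 : det * p1 = h * n1.
  have -> : h * n1 = (p1 * c1 + (p2 * c2 + p3 * c3)) * (a2 * b3 - a3 * b2)
      + (p1 * a1 + (p2 * a2 + p3 * a3)) * (b2 * c3 - b3 * c2)
      + (p1 * b1 + (p2 * b2 + p3 * b3)) * (c2 * a3 - c3 * a2).
    by rewrite pA pB pC /n1; ring.
  by rewrite /det; ring.
have d2 : det * p2 = h * n2.
  have -> : h * n2 = (p1 * c1 + (p2 * c2 + p3 * c3)) * (a3 * b1 - a1 * b3)
      + (p1 * a1 + (p2 * a2 + p3 * a3)) * (b3 * c1 - b1 * c3)
      + (p1 * b1 + (p2 * b2 + p3 * b3)) * (c3 * a1 - c1 * a3).
    by rewrite pA pB pC /n2; ring.
  by rewrite /det; ring.
have d3 : det * p3 = h * n3.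
  have -> : h * n3 = (p1 * c1 + (p2 * c2 + p3 * c3)) * (a1 * b2 - a2 * b1)
      + (p1 * a1 + (p2 * a2 + p3 * a3)) * (b1 * c2 - b2 * c1)
      + (p1 * b1 + (p2 * b2 + p3 * b3)) * (c1 * a2 - c2 * a1).
    by rewrite pA pB pC /n3; ring.
  by rewrite /det; ring.
set BC := b1 * c1 + _; set CA := c1 * a1 + _; set AB := a1 * b1 + _.
set u := 1 - BC; set v := 1 - CA; set w := 1 - AB.
have gramE : gram BC CA AB = det ^+ 2.
  have -> : det ^+ 2 = (a1 * a1 + (a2 * a2 + a3 * a3))
      * (b1 * b1 + (b2 * b2 + b3 * b3)) * (c1 * c1 + (c2 * c2 + c3 * c3))
    + 2 * BC * CA * AB - (a1 * a1 + (a2 * a2 + a3 * a3)) * BC ^+ 2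
    - (b1 * b1 + (b2 * b2 + b3 * b3)) * CA ^+ 2
    - (c1 * c1 + (c2 * c2 + c3 * c3)) * AB ^+ 2.
    by rewrite /det /BC /CA /AB; ring.
  by rewrite AA BB CC /gram; ring.
split; first by rewrite gramE sqr_ge0.
(* The vector is [(B - A) x (C - A)], so this is Heron's formula in the squared chords [2 u], [2 v],
   [2 w]. *)
have nE : n1 ^+ 2 + n2 ^+ 2 + n3 ^+ 2 =
    2 * (u * v + v * w + w * u) - u ^+ 2 - v ^+ 2 - w ^+ 2.
  have uE : 2 * u = (b1 - c1) ^+ 2 + (b2 - c2) ^+ 2 + (b3 - c3) ^+ 2.
    have -> : 2 * u = (b1 * b1 + (b2 * b2 + b3 * b3))
        + (c1 * c1 + (c2 * c2 + c3 * c3)) - 2 * BC.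
      by rewrite BB CC /u; ring.
    by rewrite /BC; ring.
  have vE : 2 * v = (c1 - a1) ^+ 2 + (c2 - a2) ^+ 2 + (c3 - a3) ^+ 2.
    have -> : 2 * v = (c1 * c1 + (c2 * c2 + c3 * c3))
        + (a1 * a1 + (a2 * a2 + a3 * a3)) - 2 * CA.
      by rewrite CC AA /v; ring.
    by rewrite /CA; ring.
  have wE : 2 * w = (a1 - b1) ^+ 2 + (a2 - b2) ^+ 2 + (a3 - b3) ^+ 2.
    have -> : 2 * w = (a1 * a1 + (a2 * a2 + a3 * a3))
        + (b1 * b1 + (b2 * b2 + b3 * b3)) - 2 * AB.
      by rewrite AA BB /w; ring.
    by rewrite /AB; ring.
  apply: (@mulfI _ 4); first by rewrite pnatr_eq0.
  have -> : 4 * (2 * (u * v + v * w + w * u) - u ^+ 2 - v ^+ 2 - w ^+ 2) =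
    2 * (2 * u * (2 * v) + 2 * v * (2 * w) + 2 * w * (2 * u))
    - (2 * u) ^+ 2 - (2 * v) ^+ 2 - (2 * w) ^+ 2 by ring.
  rewrite uE vE wE /n1 /n2 /n3; ring.
rewrite gramE -nE -[LHS]mulr1 -pp.
have -> : det ^+ 2 * (p1 * p1 + (p2 * p2 + p3 * p3)) =
  (det * p1) ^+ 2 + (det * p2) ^+ 2 + (det * p3) ^+ 2 by ring.
by rewrite d1 d2 d3; ring.
Qed.

End Vectors.

(** * Half chords of a spherical triangle; Euclidean triangles with given sides *)

Lemma heron_triangle (R : realType) (x y z : R) : 0 < x -> 0 < y -> 0 < z ->
  0 < heron x y z -> x < y + z.
Proof.
move=> x0 y0 z0; rewrite ltNge => /negP K0; rewrite ltNge; apply/negP => xyz.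
apply: K0; rewrite -oppr_ge0.
have -> : - heron x y z =
    (x + y + z) * (x - (y + z)) * ((z + x - y) * (x + y - z)).
  by rewrite /heron; ring.
by apply: mulr_ge0; apply: mulr_ge0; lra.
Qed.

(** The Gram determinant is [P^2 - N^2] with [N / P] the cosine of the angle at [A], hence nonzero.
    It equals both [4 heron - 16 x^2 y^2 z^2] and [4 h^2 heron]: this gives the radius equation and
    [heron > 0], hence the triangle inequalities. *)
Lemma half_chords_sphere (R : realType) (A B C p : 'rV[R]_3) (h : R) :
  enorm A = 1 -> enorm B = 1 -> enorm C = 1 -> enorm p = 1 ->
  dotp p A = h -> dotp p B = h -> dotp p C = h -> 0 < h ->
  -1 < dotp A B < 1 -> -1 < dotp B C < 1 -> -1 < dotp C A < 1 ->
  0 < sph_angle A B C < pi ->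
  half_chords h (half_chord B C) (half_chord C A) (half_chord A B).
Proof.
move=> A1 B1 C1 p1 pA pB pC h0 /andP[AB0 AB] /andP[BC0 BC] /andP[CA0 CA].
have [G0 GE] := gram_circumcenter A1 B1 C1 p1 pA pB pC.
rewrite sph_angle_dotp//; set P := _ * Num.sqrt _ => aP.
have sq (u : R) : -1 < u -> u < 1 -> 0 < 1 - u ^+ 2.
  move=> u0 u1; have -> : 1 - u ^+ 2 = (1 - u) * (1 + u) by ring.
  by apply: mulr_gt0; lra.
have P0 : 0 < P by rewrite mulr_gt0// sqrtr_gt0 sq.
have GP : gram (dotp B C) (dotp C A) (dotp A B) =
    (P - (dotp B C - dotp A B * dotp C A)) * (P + (dotp B C - dotp A B * dotp C A)).
  rewrite -subr_sqr exprMn !sqr_sqrtr ?ltW ?sq// /gram; ring.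
have {}G0 : 0 < gram (dotp B C) (dotp C A) (dotp A B).
  rewrite lt_neqAle G0 andbT eq_sym; apply/eqP => Gz.
  move: Gz; rewrite GP => /eqP; rewrite mulf_eq0 => /orP[]/eqP NP; move: aP.
    have -> : dotp B C - dotp A B * dotp C A = P by lra.
    by rewrite divff ?gt_eqF// acos1 ltxx.
  have -> : dotp B C - dotp A B * dotp C A = - P by lra.
  by rewrite mulNr divff ?gt_eqF// acosN1 ltxx andbF.
have x2 := half_chord_sqr (ltW BC); have y2 := half_chord_sqr (ltW CA).
have z2 := half_chord_sqr (ltW AB); have x0 := half_chord_gt0 BC.
have y0 := half_chord_gt0 CA; have z0 := half_chord_gt0 AB.
set x := half_chord B C in x2 x0 *; set y := half_chord C A in y2 y0 *.
set z := half_chord A B in z2 z0 *.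
have BCE : dotp B C = 1 - 2 * x ^+ 2 by rewrite x2; field.
have CAE : dotp C A = 1 - 2 * y ^+ 2 by rewrite y2; field.
have ABE : dotp A B = 1 - 2 * z ^+ 2 by rewrite z2; field.
have GK : gram (dotp B C) (dotp C A) (dotp A B) =
    4 * heron x y z - 16 * (x ^+ 2 * y ^+ 2 * z ^+ 2).
  by rewrite BCE CAE ABE /gram /heron; ring.
have GH : gram (dotp B C) (dotp C A) (dotp A B) = h ^+ 2 * (4 * heron x y z).
  by rewrite GE BCE CAE ABE /heron; ring.
have K0 : 0 < heron x y z.
  by move: G0; rewrite GH pmulr_rgt0 ?exprn_gt0// pmulr_rgt0.
split=> //.
- split; first exact: heron_triangle.
  + by apply: heron_triangle => //; move: K0; congr (0 < _); rewrite /heron; ring.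
  + by apply: heron_triangle => //; move: K0; congr (0 < _); rewrite /heron; ring.
- by move: GH; rewrite GK; lra.
Qed.

Lemma edist_eq0 (R : realType) n (A : 'rV[R]_n) : edist A A = 0.
Proof.
rewrite /edist /enorm subrr /dotp big1 ?sqrtr0// => i _.
by rewrite mxE mul0r.
Qed.

(** [A] is the origin, [B] lies on the first axis, and the law of cosines gives the direction of
    [C]. *)
Lemma euclidean_triangle_exists (R : realType) (p q r : R) :
  0 < p -> 0 < q -> 0 < r -> p < q + r -> q < r + p -> r < p + q ->
  exists A B C : 'rV[R]_2, [/\ euclidean_triangle (Triangle A B C),
    edist B C = p, edist C A = q & edist A B = r].
Proof.
move=> p0 q0 r0 pqr qrp rpq.
have /andP[c0 c1] := eucl_cos_itv q0 r0 pqr qrp rpq.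
pose c := eucl_cos p q r; pose s := Num.sqrt (1 - c ^+ 2).
have s2 : s ^+ 2 = 1 - c ^+ 2.
  rewrite sqr_sqrtr//; have -> : 1 - c ^+ 2 = (1 - c) * (1 + c) by ring.
  by apply: mulr_ge0; rewrite /c; lra.
pose pt (u v : R) : 'rV[R]_2 := \row_(i < 2) if i == ord0 then u else v.
have ptE u v u' v' : edist (pt u v) (pt u' v') =
    Num.sqrt ((u - u') ^+ 2 + (v - v') ^+ 2).
  by rewrite /edist /enorm /dotp !big_ord_recl big_ord0 addr0 !mxE.
have dBC : edist (pt r 0) (pt (q * c) (q * s)) = p.
  rewrite ptE sub0r sqrrN.
  have -> : (r - q * c) ^+ 2 + (q * s) ^+ 2 = p ^+ 2.
    rewrite [(q * s) ^+ 2]exprMn s2.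
    have -> : (r - q * c) ^+ 2 + q ^+ 2 * (1 - c ^+ 2) =
      r ^+ 2 + q ^+ 2 - 2 * q * r * c by ring.
    rewrite /c /eucl_cos mulrC divfK; first by ring.
    by rewrite !mulf_neq0 ?gt_eqF.
  by rewrite sqrtr_sqr gtr0_norm.
have dCA : edist (pt (q * c) (q * s)) (pt 0 0) = q.
  rewrite ptE !subr0 [(q * s) ^+ 2]exprMn s2.
  have -> : (q * c) ^+ 2 + q ^+ 2 * (1 - c ^+ 2) = q ^+ 2 by ring.
  by rewrite sqrtr_sqr gtr0_norm.
have dAB : edist (pt 0 0) (pt r 0) = r.
  by rewrite ptE subrr sub0r expr0n addr0 sqrrN sqrtr_sqr gtr0_norm.
exists (pt 0 0), (pt r 0), (pt (q * c) (q * s)); split=> //.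
have neq (A B : 'rV[R]_2) t : 0 < t -> edist A B = t -> A != B.
  by move=> t0 AB; apply/eqP => E; move: t0; rewrite -AB E edist_eq0 ltxx.
rewrite /= !eucl_angleE dBC dCA dAB; split.
  by split; [exact: neq dAB|exact: neq dBC|exact: neq dCA].
by split; apply: acos_itv; apply: eucl_cos_itv.
Qed.

(** * The distortion bound for spherical triangles *)

Theorem theorem1p5 (R : realType) (eps : R) (heps : 0 < eps < b0 R) :
  exists k delta : R, [/\ 1 <= k, 0 < delta
    & forall D : triangle 'rV[R]_3, spherical_triangle D ->
      forall r : R, circumscribed_radius D r -> r <= b0 R - eps ->
        (exists D' : triangle 'rV[R]_2, image_triangle (Fk k) D D') /\
        (forall D' : triangle 'rV[R]_2, image_triangle (Fk k) D D' ->
           1 / 2 + delta <= angle_distortion D D')].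
Proof.
have /andP[e0 eb] := heps.
have i3 : -1 < (1 / 3 : R) < 1 by apply/andP; split; lra.
have bpi : b0 R < pi by rewrite b0_acos; have /andP[] := acos_itv i3.
have cb : cos (b0 R) = 1 / 3 by rewrite b0_acos cos_acos.
(* Cosine decreases and [cos b0 = 1/3], so [eta > 0], and [r <= b0 - eps] gives
   [cos r >= 1/3 + eta]. *)
pose eta := cos (b0 R - eps) - 1 / 3.
have eta0 : 0 < eta.
  by rewrite /eta subr_gt0 -cb ltr_cos ?in_itv/=; lra.
have delta0 : 0 < eta / 480 / 1000 by lra.
exists 10, (eta / 480 / 1000); split; [lra|by []|].
move=> [A B C] [[A1 B1 C1] [aBC aCA aAB] [sA sB sC]] r [p [p1 [pA pB pC] _]] rb.
have /= rA := pA; have /= rB := pB; have /= rC := pC.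
have iAB := dotp_itv A1 B1 aAB; have iBC := dotp_itv B1 C1 aBC.
have iCA := dotp_itv C1 A1 aCA.
pose h := cos r.
have dE (X : 'rV[R]_3) : enorm X = 1 -> sdist p X = r -> dotp p X = h.
  by move=> X1 pX; rewrite /h -pX /sdist acosK// in_itv/= dotp_bound.
have r0 : 0 <= r by rewrite -rA acos_ge0// dotp_bound.
have hh : 1 / 3 + eta <= h.
  rewrite /eta addrC subrK /h leNgt ltr_cos ?in_itv/=; lra.
have h0 : 0 < h by lra.
have hc := half_chords_sphere A1 B1 C1 p1 (dE _ A1 rA) (dE _ B1 rB) (dE _ C1 rC)
  h0 iAB iBC iCA sA.
(* The rotations supply the estimates at the other two vertices. *)
have hcB := half_chords_rot hc; have hcC := half_chords_rot hcB.
rewrite /image_triangle /= !Fk_sdist//; split.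
  case: (hc) => -[x0 y0 z0] [xyz yzx zxy] _ _.
  have [A' [B' [C' [T d1 d2 d3]]]] := euclidean_triangle_exists
    (scale_gt0 x0) (scale_gt0 y0) (scale_gt0 z0) (scale_triangle x0 y0 z0 xyz)
    (scale_triangle y0 z0 x0 yzx) (scale_triangle z0 x0 y0 zxy).
  by exists (Triangle A' B' C').
move=> [A' B' C'] [_ /= d1 d2 d3].
have [[/andP[sA0 _] /andP[sB0 _]] /andP[sC0 _]] := (sA, sB, sC).
rewrite !le_min !ler_pdivlMr//.
rewrite !eucl_angleE d1 d2 d3 !sph_angleE//.
by rewrite !(angle_distort _ eta0 hh).
Qed.
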